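(* Let $E: y^2=x^3+ax^2+bx+c$ ($a,b,c\in\mathbb{Z}$) be an elliptic curve and $P\in E(\mathbb{Q})$ a point of infinite order. The sequence $(|\tau_k|)_{k\ge1}$ is eventually periodic, and there is an algorithm which, given $E$ and $P$, computes $|\tau_k|$ for all $k\ge1$.
   Context: An elliptic curve is a non-singular cubic $y^2=x^3+ax^2+bx+c$ with $a,b,c\in\mathbb{Z}$. For $k\ge0$ write $2^kP=\left(\frac{m_k}{e_k^2},\frac{n_k}{e_k^3}\right)$ with $m_k,n_k,e_k\in\mathbb{Z}$, $e_k\ge1$, $\gcd(m_k,e_k)=\gcd(n_k,e_k)=1$. Define $F_0(E,P)=e_0$, $F_k(E,P)=e_k/e_{k-1}$ for $k\ge1$, and $\tau_k=\frac{2n_{k-1}}{F_k(E,P)}$ for $k\ge1$ (an integer). *)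

(* Defs.v *)
From HB Require Import structures.
From mathcomp Require Import all_boot all_order all_algebra all_field.
From mathcomp Require Import ring.
Set Implicit Arguments. Unset Strict Implicit. Unset Printing Implicit Defensive.
Import Order.TTheory GRing.Theory Num.Theory.
Local Open Scope ring_scope.

(* The cubic y^2 = x^3 + a x^2 + b x + c. *)
Record curve := Curve { ca : int; cb : int; cc : int }.

Definition rhs (K : unitRingType) (E : curve) (x : K) : K :=
  x ^+ 3 + (ca E)%:~R * x ^+ 2 + (cb E)%:~R * x + (cc E)%:~R.

Definition drhs (K : unitRingType) (E : curve) (x : K) : K :=
  3%:R * x ^+ 2 + 2%:R * (ca E)%:~R * x + (cb E)%:~R.

(* A common zero of y^2 - f(x) and its two partial derivatives; the point at
   infinity is smooth for every such cubic. *)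
Definition singular_point (E : curve) (x y : algC) : Prop :=
  [/\ y ^+ 2 = rhs E x, 2%:R * y = 0 & - drhs E x = 0].

Definition elliptic (E : curve) : Prop :=
  forall x y : algC, ~ singular_point E x y.

Inductive point := Inf | Aff of rat & rat.

Definition on_curve (E : curve) (P : point) : Prop :=
  if P is Aff x y then y ^+ 2 = rhs E x else True.

Definition add_slope (E : curve) (l x1 y1 x2 : rat) : point :=
  let x3 := l ^+ 2 - (ca E)%:~R - x1 - x2 in
  Aff x3 (l * (x1 - x3) - y1).

Definition addpt (E : curve) (P Q : point) : point :=
  match P, Q with
  | Inf, _ => Q
  | _, Inf => P
  | Aff x1 y1, Aff x2 y2 =>
    if x1 != x2 then add_slope E ((y2 - y1) / (x2 - x1)) x1 y1 x2
    else if y1 == - y2 then Inf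
    else add_slope E (drhs E x1 / (2%:R * y1)) x1 y1 x2
  end.

Definition mulpt (E : curve) (n : nat) (P : point) : point :=
  iter n (addpt E P) Inf.

Definition infinite_order (E : curve) (P : point) : Prop :=
  forall n : nat, (0 < n)%N -> mulpt E n P <> Inf.

Definition lowest_form (P : point) (m n e : int) : Prop :=
  [/\ P = Aff (m%:~R / e%:~R ^+ 2) (n%:~R / e%:~R ^+ 3),
      1 <= e, gcdz m e = 1 & gcdz n e = 1].

Definition doubling_forms (E : curve) (P : point) (m n e : nat -> int) : Prop :=
  forall k : nat, lowest_form (mulpt E (2 ^ k) P) (m k) (n k) (e k).

Definition fermat (e : nat -> int) (k : nat) : rat :=
  if k is k'.+1 then (e k)%:~R / (e k')%:~R else (e 0%N)%:~R.

(* Meaningful for k >= 1 only. *)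
Definition tau (n e : nat -> int) (k : nat) : rat :=
  2%:R * (n k.-1)%:~R / fermat e k.

Definition eventually_periodic (T : Type) (u : nat -> T) : Prop :=
  exists N p : nat, (0 < p)%N /\ forall k : nat, (N <= k)%N -> u (k + p)%N = u k.

(* Algorithms are programs of a WHILE language with integer variables and a
   write-only output tape. *)
Inductive expr :=
  | Cst of int
  | Var of nat
  | Add of expr & expr
  | Sub of expr & expr
  | Mul of expr & expr
  | Div of expr & expr
  | Mod of expr & expr.

(* If and While branch on whether the value of the test is positive. *)
Inductive prog :=
  | Skip
  | Assign of nat & expr
  | Print of expr
  | Seq of prog & prog
  | If of expr & prog & prog
  | While of expr & prog.

Definition store := nat -> int.

Fixpoint eval (s : store) (t : expr) : int :=
  match t with
  | Cst z => z
  | Var i => s i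
  | Add t1 t2 => eval s t1 + eval s t2
  | Sub t1 t2 => eval s t1 - eval s t2
  | Mul t1 t2 => eval s t1 * eval s t2
  | Div t1 t2 => (eval s t1 %/ eval s t2)%Z
  | Mod t1 t2 => (eval s t1 %% eval s t2)%Z
  end.

Definition upd (s : store) (i : nat) (z : int) : store :=
  fun j => if j == i then z else s j.

(* [exec c s s' o]: started in s, c halts in s' after printing exactly o. *)
Inductive exec : prog -> store -> store -> seq int -> Prop :=
  | exec_skip s : exec Skip s s [::]
  | exec_assign s i t : exec (Assign i t) s (upd s i (eval s t)) [::]
  | exec_print s t : exec (Print t) s s [:: eval s t]
  | exec_seq c1 c2 s s1 s2 o1 o2 :
      exec c1 s s1 o1 -> exec c2 s1 s2 o2 ->
      exec (Seq c1 c2) s s2 (o1 ++ o2)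
  | exec_if_true t c1 c2 s s1 o :
      0 < eval s t -> exec c1 s s1 o -> exec (If t c1 c2) s s1 o
  | exec_if_false t c1 c2 s s1 o :
      eval s t <= 0 -> exec c2 s s1 o -> exec (If t c1 c2) s s1 o
  | exec_while_done t c s :
      eval s t <= 0 -> exec (While t c) s s [::]
  | exec_while_step t c s s1 s2 o1 o2 :
      0 < eval s t -> exec c s s1 o1 -> exec (While t c) s1 s2 o2 ->
      exec (While t c) s s2 (o1 ++ o2).

(* Denominators are nonzero, so Inf is not confused with an affine point. *)
Definition input (E : curve) (P : point) : store :=
  nth 0 ([:: ca E; cb E; cc E] ++
         (if P is Aff x y then [:: numq x; denq x; numq y; denq y] else [::])).

Definition run (c : prog) (E : curve) (P : point) (o : seq int) : Prop :=
  exists s : store, exec c (input E P) s o.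

(* The finite output [size pre :: pre ++ cyc] stands for the infinite sequence
   consisting of pre followed by cyc repeated forever. *)
Definition describes (o : seq int) (u : nat -> rat) : Prop :=
  exists pre cyc : seq int,
    [/\ o = (size pre)%:Z :: pre ++ cyc, (0 < size cyc)%N
      & forall k : nat,
          u k = (if (k < size pre)%N then nth 0 pre k
                 else nth 0 cyc ((k - size pre) %% size cyc)%N)%:~R].

Lemma exec_det c s s1 s2 o1 o2 :
  exec c s s1 o1 -> exec c s s2 o2 -> s1 = s2 /\ o1 = o2.
Proof.
move=> H; elim: H s2 o2 => {c s s1 o1} [s|s i t|s t
  |c1 c2 s s1 s2 o1 o2 _ IH1 _ IH2|t c1 c2 s s1 o pos _ IH
  |t c1 c2 s s1 o neg _ IH|t c s neg|t c s s1 s2 o1 o2 pos _ IH1 _ IH2] s3 o3 H.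
- by inversion H.
- by inversion H.
- by inversion H.
- inversion H as [| | |? ? ? s4 ? o4 ? E1 E2| | | |]; subst.
  by have [? ?] := IH1 _ _ E1; subst; have [-> ->] := IH2 _ _ E2.
- inversion H as [| | | |? ? ? ? ? ? L E1|? ? ? ? ? ? L E1| |]; subst.
    exact: IH.
  by rewrite leNgt pos in L.
- inversion H as [| | | |? ? ? ? ? ? L E1|? ? ? ? ? ? L E1| |]; subst.
    by rewrite ltNge neg in L.
  exact: IH.
- inversion H as [| | | | | | |? ? ? ? ? ? ? L]; subst => //.
  by rewrite ltNge neg in L.
- inversion H as [| | | | | |? ? ? L|? ? ? s4 ? o4 ? L E1 E2]; subst.
    by rewrite leNgt pos in L.
  by have [? ?] := IH1 _ _ E1; subst; have [-> ->] := IH2 _ _ E2.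
Qed.

Lemma on_curve_add E P Q :
  on_curve E P -> on_curve E Q -> on_curve E (addpt E P Q).
Proof.
case: P Q => [|x1 y1] [|x2 y2] //=; rewrite /rhs => H1 H2.
case: (eqVneq x1 x2) => [e12|ne] /=.
  rewrite -{}e12 in H2 *; case: eqVneq => //= ny.
  have yy : y1 = y2.
    have : (y1 - y2) * (y1 + y2) = 0 by rewrite -subr_sqr H1 H2 subrr.
    by move/eqP; rewrite mulf_eq0 subr_eq0 addr_eq0 (negPf ny) orbF => /eqP.
  have y0 : y1 != 0.
    by apply: contraNneq ny; rewrite -yy => ->; rewrite oppr0.
  rewrite /add_slope /drhs /on_curve /rhs.
  set a : rat := (ca E)%:~R; set b : rat := (cb E)%:~R.
  have -> : (cc E)%:~R = y1 ^+ 2 - (x1 ^+ 3 + a * x1 ^+ 2 + b * x1).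
    by rewrite H1; ring.
  by field.
have d0 : x2 - x1 != 0 by rewrite subr_eq0 eq_sym.
rewrite /add_slope /on_curve /rhs; move: H1 H2.
set a : rat := (ca E)%:~R; set b : rat := (cb E)%:~R.
set c : rat := (cc E)%:~R => H1 H2.
have Db : b = (y2 ^+ 2 - y1 ^+ 2 - (x2 ^+ 3 - x1 ^+ 3)
    - a * (x2 ^+ 2 - x1 ^+ 2)) / (x2 - x1) by rewrite H1 H2; field.
have -> : c = y1 ^+ 2 - (x1 ^+ 3 + a * x1 ^+ 2 + b * x1) by rewrite H1; ring.
by rewrite Db; field.
Qed.

Lemma lowest_form_exists E x y :
  on_curve E (Aff x y) -> exists m n e, lowest_form (Aff x y) m n e.
Proof.
rewrite /= /rhs => H0.
have q0 := denq_neq0 x; have s0 := denq_neq0 y.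
have qp := denq_gt0 x; have sp := denq_gt0 y.
have cx : coprimez (numq x) (denq x) by exact: coprime_num_den.
have cy : coprimez (numq y) (denq y) by exact: coprime_num_den.
move: (divq_num_den x) (divq_num_den y) q0 s0 qp sp cx cy.
set p := numq x; set q := denq x; set r := numq y; set s := denq y.
move=> Dx Dy q0 s0 qp sp cx cy; have H := H0; rewrite -Dx -Dy in H.
have q0' : q%:~R != 0 :> rat by rewrite intr_eq0.
have s0' : s%:~R != 0 :> rat by rewrite intr_eq0.
set t := p ^+ 3 + q * (ca E * p ^+ 2 + cb E * p * q + cc E * q ^+ 2).
have key : r ^+ 2 * q ^+ 3 = s ^+ 2 * t.
  apply/eqP; rewrite -(eqr_int rat) /t; apply/eqP.
  rewrite !(rmorphM, rmorphD, rmorphXn) /=.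
  have -> : r%:~R ^+ 2 = (r%:~R / s%:~R) ^+ 2 * s%:~R ^+ 2 :> rat by field.
  by rewrite H; field.
have cqt : coprimez (q ^+ 3) t.
  apply: coprimezXl; rewrite /t addrC [q * _]mulrC /coprimez gcdzMDl.
  by rewrite -/(coprimez _ _); apply: coprimezXr; rewrite coprimez_sym.
have d1 : (q ^+ 3 %| s ^+ 2)%Z.
  by rewrite -(Gauss_dvdzl (s ^+ 2) cqt) -key dvdz_mull.
have d2 : (s ^+ 2 %| q ^+ 3)%Z.
  have c2 : coprimez (s ^+ 2) (r ^+ 2).
    by apply: coprimezXl; apply: coprimezXr; rewrite coprimez_sym.
  by rewrite -(Gauss_dvdzr (q ^+ 3) c2) key dvdz_mulr.
have sq : s ^+ 2 = q ^+ 3.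
  have /eqP : `|s ^+ 2|%N == `|q ^+ 3|%N by rewrite eqn_dvd; apply/andP.
  move/(congr1 Posz); rewrite !abszE !ger0_norm //; apply: exprn_ge0; exact: ltW.
have /dvdzP[e se] : (q %| s)%Z.
  have : (q ^+ 2 %| s ^+ 2)%Z by rewrite sq exprS dvdz_mull.
  by rewrite !dvdzE !abszX dvdn_pexp2r.
have qe : q = e ^+ 2.
  have q2 : q ^+ 2 != 0 by rewrite expf_neq0.
  by apply: (mulIf q2); rewrite -exprS -sq se exprMn.
have e_gt0 : 0 < e by rewrite -(pmulr_lgt0 e qp) -se.
have se3 : s = e ^+ 3 by rewrite se qe -exprS.
exists p, r, e; split => //.
- by rewrite -rmorphXn -rmorphXn /= -qe -se3 Dx Dy.
- by apply/eqP; move: cx; rewrite qe coprimez_pexpr.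
- by apply/eqP; move: cy; rewrite se3 coprimez_pexpr.
Qed.

Lemma doubling_forms_exists E P :
  on_curve E P -> infinite_order E P ->
  exists m n e : nat -> int, doubling_forms E P m n e.
Proof.
move=> cP oP.
have cM k : on_curve E (mulpt E k P) by elim: k => //= k; exact: on_curve_add.
have ex k : exists z : int * int * int,
    lowest_form (mulpt E (2 ^ k) P) z.1.1 z.1.2 z.2.
  have p2 : (0 < 2 ^ k)%N by rewrite expn_gt0.
  move: (cM (2 ^ k)%N) (oP _ p2).
  case: (mulpt E _ P) => [|x y] // /lowest_form_exists [m [n [e H]]] _.
  by exists (m, n, e).
suff [f Hf] : exists f : nat -> int * int * int,
    forall k, lowest_form (mulpt E (2 ^ k) P) (f k).1.1 (f k).1.2 (f k).2.
  by exists (fun k => (f k).1.1), (fun k => (f k).1.2), (fun k => (f k).2).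
pose pt Q z : bool := if Q is Aff x y then
   [&& x == z.1.1%:~R / z.2%:~R ^+ 2, y == z.1.2%:~R / z.2%:~R ^+ 3,
       1 <= z.2, gcdz z.1.1 z.2 == 1 & gcdz z.1.2 z.2 == 1] else false.
have ptP Q (z : int * int * int) :
    reflect (lowest_form Q z.1.1 z.1.2 z.2) (pt Q z).
  case: Q => [|x y] /=; first by constructor; case.
  apply: (iffP and5P) => [[/eqP-> /eqP-> ? /eqP? /eqP?]|[[-> ->] ? /eqP? /eqP?]].
    by split.
  by split.
have exb k : exists z, pt (mulpt E (2 ^ k) P) z.
  by have [z /ptP] := ex k; exists z.
by exists (fun k => xchoose (exb k)) => k; apply/ptP; exact: (xchooseP (exb k)).
Qed.

(* Main.v *)
Require Import Defs.
From mathcomp Require Import all_boot all_order all_algebra all_field.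
From mathcomp Require Import ring zify.
Set Implicit Arguments. Unset Strict Implicit. Unset Printing Implicit Defensive.
Import Order.TTheory GRing.Theory Num.Theory.
Local Open Scope ring_scope.

(** Write Q_k = 2^k P = (m_k / e_k^2, n_k / e_k^3). Before cancellation,
    x(2Q) = A / (4 n^2 e^2) with A a form in m and e^2 prime to e, so that
    tau^2 = gcd(A, 4 n^2), and this divides D, four times the discriminant.

    Suppose the triples (m, n, e) at k < l agree modulo D^2, and let p be a prime
    with p^d the exact power dividing D. Once p divides e, it never divides tau
    again. Otherwise S = Q_l - Q_k lies in the d-th kernel of reduction at p
    (unless n_k is so divisible by p that p divides e_(k+1)); then so does
    2^j S, and Q_(l+j) = Q_(k+j) + 2^j S has the same abscissa as Q_(k+j)
    modulo p^d, hence the same p-part of tau. Thus tau has period l - k from k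
    on. By the pigeonhole principle such k < l <= N = D^6 exist, so N is a
    preperiod and N! a period: an algorithm need not search for the period, it
    only has to print the first N + N! values.

    Associativity of the addition is read off the parabola y = q(x) through
    P, Q, R: its fourth intersection with the curve is -((P + Q) + R), and it
    does not depend on the order of the points. *)

(** * Group law *)

Definition oppt (P : point) : point := if P is Aff x y then Aff x (- y) else Inf.

Lemma eq_point_dec (P Q : point) : P = Q \/ P <> Q.
Proof.
case: P Q => [|x y] [|x' y']; [by left | by right | by right | ].
case: (eqVneq x x') => [->|/eqP nx]; last by right; case.
by case: (eqVneq y y') => [->|/eqP ny]; [left|right; case].
Qed.

Lemma opptK P : oppt (oppt P) = P.
Proof. by case: P => //= x y; rewrite opprK. Qed.

Lemma oppt_on E P : on_curve E P -> on_curve E (oppt P).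
Proof. by case: P => //= x y; rewrite sqrrN. Qed.

Lemma addptC E P Q : on_curve E P -> on_curve E Q -> addpt E P Q = addpt E Q P.
Proof.
case: P Q => [|x1 y1] [|x2 y2] //= c1 c2.
rewrite [x2 == x1]eq_sym; case: (eqVneq x1 x2) => [e12|x12] /=; last first.
  rewrite /add_slope; have d1 : x2 - x1 != 0 by rewrite subr_eq0 eq_sym.
  have d2 : x1 - x2 != 0 by rewrite subr_eq0.
  by congr Aff; field; rewrite d1 d2.
rewrite -e12 in c2 *; have -> : (y2 == - y1) = (y1 == - y2) by rewrite eq_sym eqr_oppLR.
case: eqVneq => // y12; suff -> : y1 = y2 by [].
apply/eqP; rewrite -subr_eq0; have : (y1 - y2) * (y1 + y2) == 0.
  by rewrite -subr_sqr c1 c2 subrr.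
by rewrite mulf_eq0 [y1 + y2 == 0]addr_eq0 (negPf y12) orbF.
Qed.

(* The line y = l x + v meets the curve exactly at the abscissae x1, x2, x3:
   these are the coefficients of
   f(x) - (l x + v)^2 = (x - x1)(x - x2)(x - x3). *)
Definition collinear (E : curve) (l v x1 x2 x3 : rat) : Prop :=
  [/\ x1 + x2 + x3 = l ^+ 2 - (ca E)%:~R,
      x1 * x2 + x1 * x3 + x2 * x3 = (cb E)%:~R - 2%:R * l * v
    & x1 * x2 * x3 = v ^+ 2 - (cc E)%:~R].

(** For equal abscissae the two points coincide and the last hypothesis makes y1 nonzero. Reading a
    and b off the coefficients then gives f'(x1) = 2 l y1, so l is the tangent slope. *)
Lemma addpt_collinear E l v x1 y1 x2 y2 x3 :
  collinear E l v x1 x2 x3 -> y1 = l * x1 + v -> y2 = l * x2 + v ->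
  Aff x2 y2 <> Aff x1 (- y1) ->
  addpt E (Aff x1 y1) (Aff x2 y2) = Aff x3 (- (l * x3 + v)).
Proof.
move=> [s1 s2 s3] e1 e2 nop /=; rewrite /add_slope.
have x3E : x3 = l ^+ 2 - (ca E)%:~R - x1 - x2 by rewrite -s1; ring.
case: (eqVneq x1 x2) => [e12|x12] /=; last first.
  have d : x2 - x1 != 0 by rewrite subr_eq0 eq_sym.
  have -> : (y2 - y1) / (x2 - x1) = l by rewrite e1 e2; field.
  by rewrite -x3E; congr Aff; rewrite e1; ring.
have y12 : y2 = y1 by rewrite e1 e2 e12.
rewrite y12 eq_sym eqNr; case: eqVneq => [y0|y0].
  by case: nop; rewrite y12 y0 oppr0 e12.
have -> : drhs E x1 / (2%:R * y1) = l.
  have : drhs E x1 = l * (2%:R * y1).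
    have aE : (ca E)%:~R = l ^+ 2 - (x1 + x2 + x3) by rewrite s1; ring.
    have bE : (cb E)%:~R = x1 * x2 + x1 * x3 + x2 * x3 + 2%:R * l * v.
      by rewrite s2; ring.
    by rewrite /drhs aE bE -e12 e1; ring.
  by move=> ->; field.
by rewrite -x3E; congr Aff; rewrite e1; ring.
Qed.

Lemma addpt_affine E x1 y1 x2 y2 :
  on_curve E (Aff x1 y1) -> on_curve E (Aff x2 y2) ->
  Aff x2 y2 <> Aff x1 (- y1) ->
  exists l v x3, [/\ collinear E l v x1 x2 x3, y1 = l * x1 + v,
    y2 = l * x2 + v & addpt E (Aff x1 y1) (Aff x2 y2) = Aff x3 (- (l * x3 + v))].
Proof.
move=> c1 c2 nop.
suff [l [v [x3 [H1 H2 H3]]]] : exists l v x3,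
    [/\ collinear E l v x1 x2 x3, y1 = l * x1 + v & y2 = l * x2 + v].
  by exists l, v, x3; split => //; apply: addpt_collinear.
move: c1 c2; rewrite /= /rhs /collinear.
set a : rat := (ca E)%:~R; set b : rat := (cb E)%:~R.
set c : rat := (cc E)%:~R => c1 c2.
have cE : c = y1 ^+ 2 - (x1 ^+ 3 + a * x1 ^+ 2 + b * x1) by rewrite c1; ring.
case: (eqVneq x1 x2) => [e12|x12]; last first.
  have d : x2 - x1 != 0 by rewrite subr_eq0 eq_sym.
  have bE : b = (y2 ^+ 2 - y1 ^+ 2 - (x2 ^+ 3 - x1 ^+ 3)
    - a * (x2 ^+ 2 - x1 ^+ 2)) / (x2 - x1) by rewrite c1 c2; field.
  pose l := (y2 - y1) / (x2 - x1).
  exists l, (y1 - l * x1), (l ^+ 2 - a - x1 - x2).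
  by split; [split; rewrite ?cE ?bE /l|rewrite /l|rewrite /l]; field.
rewrite -e12 in c2 nop *.
have y12 : y1 = y2.
  apply/eqP; rewrite -subr_eq0; have : (y1 - y2) * (y1 + y2) == 0.
    by rewrite -subr_sqr c1 c2 subrr.
  rewrite mulf_eq0 [y1 + y2 == 0]addr_eq0 => /orP[//|/eqP y12].
  by case: nop; rewrite y12 opprK.
have y0 : y1 != 0 by apply/eqP => y0; apply: nop; rewrite -y12 y0 oppr0.
pose l := (3%:R * x1 ^+ 2 + 2%:R * a * x1 + b) / (2%:R * y1).
exists l, (y1 - l * x1), (l ^+ 2 - a - x1 - x1).
by split; [split; rewrite ?cE /l|rewrite /l|rewrite /l -y12]; field.
Qed.

Lemma elliptic_smooth E (x : rat) :
  elliptic E -> rhs E x = 0 -> drhs E x != 0.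
Proof.
move=> ell f0; apply/eqP => d0; apply: (ell (ratr x) 0).
have rE : ratr (rhs E x) = rhs E (ratr x : algC).
  by rewrite /rhs !(rmorphXn, rmorphD, rmorphM, rmorph_int).
have dE : ratr (drhs E x) = drhs E (ratr x : algC).
  by rewrite /drhs !(rmorph_nat, rmorphXn, rmorphD, rmorphM, rmorph_int).
by split; rewrite -?rE -?dE ?f0 ?d0 ?rmorph0 ?mulr0 ?oppr0 // expr0n.
Qed.

Lemma addptN E P : addpt E P (oppt P) = Inf.
Proof. by case: P => //= x y; rewrite eqxx /= opprK eqxx. Qed.

Lemma addpt_eq0 E P Q :
  on_curve E P -> on_curve E Q -> addpt E P Q = Inf -> Q = oppt P.
Proof.
case: P Q => [|x1 y1] [|x2 y2] //= _ _.
case: (eqVneq x1 x2) => [->|_] //=; case: eqVneq => [->|//].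
by rewrite opprK.
Qed.

Lemma addpt_Inf E P : addpt E P Inf = P. Proof. by case: P. Qed.

(** The line through P, Q and -(P + Q), reflected in the x-axis, passes through P + Q, -P and -Q.
    The configuration to exclude is P + Q = P with P and Q affine: it would make x1 a double root of
    f. This is where smoothness enters the group law. *)
Lemma addpt_neg_cancel E P Q : elliptic E -> on_curve E P -> on_curve E Q ->
  addpt E (addpt E P Q) (oppt P) = Q.
Proof.
move=> ell cP cQ.
case: P cP => [|x1 y1] cP; first by rewrite addpt_Inf.
case: Q cQ => [|x2 y2] cQ; first by rewrite addptN.
have [op|nop] := eq_point_dec (Aff x2 y2) (Aff x1 (- y1)).
  by rewrite op -/(oppt (Aff x1 y1)) addptN.
have [l [v [x3 [[s1 s2 s3] e1 e2 ->]]]] := addpt_affine cP cQ nop.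
rewrite /oppt (@addpt_collinear E (- l) (- v) x3 _ x1 _ x2).
- by congr Aff; rewrite e2; ring.
- by split; rewrite ?sqrrN -?s1 -?s3; [ring| |ring];
    have -> : 2%:R * - l * - v = 2%:R * l * v by [ring]; rewrite -s2; ring.
- by ring.
- by rewrite e1; ring.
rewrite opprK => -[e13 y1E].
have y10 : y1 = 0.
  by apply/eqP; rewrite -eqNr y1E -e13 -e1.
have f0 : rhs E x1 = 0 by rewrite -cP y10 expr0n.
apply/negP: (elliptic_smooth ell f0); rewrite negbK; apply/eqP.
have -> : drhs E x1 = 2%:R * l * y1; last by rewrite y10 mulr0.
have aE : (ca E)%:~R = l ^+ 2 - (x1 + x2 + x3) by rewrite s1; ring.
have bE : (cb E)%:~R = x1 * x2 + x1 * x3 + x2 * x3 + 2%:R * l * v.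
  by rewrite s2; ring.
by rewrite /drhs aE bE -e13 e1; ring.
Qed.

(* The parabola y = r x^2 + s x + u meets the curve exactly at the abscissae
   x1, x2, x3, x4: these are the coefficients of
   f(x) - (r x^2 + s x + u)^2 = - r^2 (x - x1)(x - x2)(x - x3)(x - x4). *)
Definition coparabolic (E : curve) (r s u x1 x2 x3 x4 : rat) : Prop :=
  [/\ r ^+ 2 * (x1 + x2 + x3 + x4) = 1 - 2%:R * r * s,
      r ^+ 2 * (x1 * x2 + x1 * x3 + x1 * x4 + x2 * x3 + x2 * x4 + x3 * x4) =
        s ^+ 2 + 2%:R * r * u - (ca E)%:~R,
      r ^+ 2 * (x1 * x2 * x3 + x1 * x2 * x4 + x1 * x3 * x4 + x2 * x3 * x4) =
        (cb E)%:~R - 2%:R * s * u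
    & r ^+ 2 * (x1 * x2 * x3 * x4) = u ^+ 2 - (cc E)%:~R].

Lemma addpt3_coparabolic E x1 y1 x2 y2 x3 y3 :
  on_curve E (Aff x1 y1) -> on_curve E (Aff x2 y2) -> on_curve E (Aff x3 y3) ->
  Aff x2 y2 <> Aff x1 (- y1) -> Aff x3 y3 <> Aff x1 (- y1) ->
  Aff x3 y3 <> Aff x2 (- y2) ->
  addpt E (addpt E (Aff x1 y1) (Aff x2 y2)) (Aff x3 y3) <> Inf ->
  exists r s u x4, [/\ r != 0, coparabolic E r s u x1 x2 x3 x4,
    [/\ y1 = r * x1 ^+ 2 + s * x1 + u, y2 = r * x2 ^+ 2 + s * x2 + u
      & y3 = r * x3 ^+ 2 + s * x3 + u]
    & addpt E (addpt E (Aff x1 y1) (Aff x2 y2)) (Aff x3 y3) =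
      Aff x4 (- (r * x4 ^+ 2 + s * x4 + u))].
Proof.
move=> c1 c2 c3 n12 n13 n23.
have [l [v [t [[s1 s2 s3] e1 e2 Dt]]]] := addpt_affine c1 c2 n12.
have ct := on_curve_add c1 c2; rewrite Dt in ct *.
set w := - (l * t + v) in ct *; move=> nI.
have [op|nop] := eq_point_dec (Aff x3 y3) (Aff t (- w)).
  by case: nI; rewrite op -/(oppt (Aff t w)) addptN.
have [k [z [x4 [[t1 t2 t3] f1 f2 ->]]]] := addpt_affine ct c3 nop.
have aE : (ca E)%:~R = l ^+ 2 - (x1 + x2 + t) by rewrite s1; ring.
have bE : (cb E)%:~R = x1 * x2 + x1 * t + x2 * t + 2%:R * l * v.
  by rewrite s2; ring.
have cE : (cc E)%:~R = v ^+ 2 - x1 * x2 * t by rewrite s3; ring.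
rewrite aE in t1; rewrite bE in t2; rewrite cE in t3.
have zE : z = - (v + (l + k) * t) by rewrite -[z](addKr (k * t)) -f1 /w; ring.
have x4E : x4 = k ^+ 2 - l ^+ 2 + x1 + x2 - x3.
  by rewrite -[x4](addKr (t + x3)) t1; ring.
(* Subtracting the factorizations of f - (l x + v)^2 and f - (k x + z)^2 and dividing by x - t gives
   (x - x1)(x - x2) - (x - x3)(x - x4) = (l + k)((k x + z) - (l x + v)). The two keys are its values
   at x3 and x4. *)
have key : (x3 - x1) * (x3 - x2) = (l + k) * (y3 - l * x3 - v).
  apply/eqP; rewrite -subr_eq0; apply/eqP.
  have -> : 0 = x1 * x2 + x1 * t + x2 * t + 2%:R * l * v - 2%:R * k * z -
     (t * x3 + t * x4 + x3 * x4) by rewrite t2; ring.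
  by rewrite f2 zE x4E; ring.
have key4 : (x4 - x1) * (x4 - x2) = (l + k) * (k * x4 + z - l * x4 - v).
  apply/eqP; rewrite -subr_eq0; apply/eqP.
  have -> : 0 = x1 * x2 + x1 * t + x2 * t + 2%:R * l * v - 2%:R * k * z -
     (t * x3 + t * x4 + x3 * x4) by rewrite t2; ring.
  by rewrite zE x4E; ring.
(* If l + k = 0, the second line is the reflection of the first, which forces R = -P or R = -Q. *)
case: (eqVneq (l + k) 0) => [lk|lk].
  have kE : k = - l by rewrite -[k](addKr l) lk addr0.
  have y3E : y3 = - (l * x3 + v) by rewrite f2 zE lk kE; ring.
  move/eqP: key; rewrite lk mul0r mulf_eq0 !subr_eq0 => /orP[]/eqP xE.
    by case: n13; rewrite y3E xE -e1.
  by case: n23; rewrite y3E xE -e2.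
(* On the curve, with q = l x + v + r (x - x1)(x - x2),
   (y - q)(y + l x + v) = (x - x1)(x - x2)((x - t) - r (y + l x + v)),
   and y = (x - t) / r - l x - v is the line through P + Q and R. *)
pose r := (l + k)^-1; exists r, (l - r * (x1 + x2)), (v + r * (x1 * x2)), x4.
have r0 : r != 0 by rewrite invr_eq0.
have kE : k = r^-1 - l by rewrite /r invrK; ring.
have qE x y : (x - x1) * (x - x2) = (l + k) * (y - l * x - v) ->
    y = r * x ^+ 2 + (l - r * (x1 + x2)) * x + (v + r * (x1 * x2)).
  move=> h; transitivity (l * x + v + r * ((x - x1) * (x - x2))); last by ring.
  by rewrite h /r mulKf //; ring.
split => //; last 1 first.
- by congr (Aff _ (- _)); apply: qE.
- have tE : t = r * (k * x3 - l * x3 - 2%:R * v - r * ((x3 - x1) * (x3 - x2))).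
    by rewrite key f2 zE /r; field.
  by split; rewrite ?aE ?bE ?cE x4E ?tE kE; field.
- by split; [rewrite e1|rewrite e2|exact: qE]; ring.
Qed.

(** The polynomial f - q^2 has a double zero at x, so f' = 2 q q' there: the parabola is tangent to
    the curve. *)
Lemma coparabolic_double E r s u x y x3 x4 :
  coparabolic E r s u x x x3 x4 -> y = r * x ^+ 2 + s * x + u ->
  2%:R * y * (2%:R * r * x + s) = drhs E x.
Proof.
move=> [h1 h2 h3 _] ->; rewrite /drhs.
have -> : (ca E)%:~R = s ^+ 2 + 2%:R * r * u -
    r ^+ 2 * (x * x + x * x3 + x * x4 + x * x3 + x * x4 + x3 * x4).
  by rewrite h2; ring.
have -> : (cb E)%:~R = 2%:R * s * u +
    r ^+ 2 * (x * x * x3 + x * x * x4 + x * x3 * x4 + x * x3 * x4).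
  by rewrite h3; ring.
have -> : 3%:R * x ^+ 2 = 3%:R * x ^+ 2 * (r ^+ 2 * (x + x + x3 + x4) + 2%:R * r * s).
  by rewrite h1; ring.
by ring.
Qed.

Lemma quadratic_interp (r s u r' s' u' x1 x2 x3 : rat) :
  x1 != x2 -> x1 != x3 -> x2 != x3 ->
  r * x1 ^+ 2 + s * x1 + u = r' * x1 ^+ 2 + s' * x1 + u' ->
  r * x2 ^+ 2 + s * x2 + u = r' * x2 ^+ 2 + s' * x2 + u' ->
  r * x3 ^+ 2 + s * x3 + u = r' * x3 ^+ 2 + s' * x3 + u' ->
  [/\ r = r', s = s' & u = u'].
Proof.
move=> n12 n13 n23 h1 h2 h3.
have d12 : x1 - x2 != 0 by rewrite subr_eq0.
have d13 : x1 - x3 != 0 by rewrite subr_eq0.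
have d23 : x2 - x3 != 0 by rewrite subr_eq0.
pose q r s u (x : rat) : rat := r * x ^+ 2 + s * x + u.
have rE r0 s0 u0 (f := q r0 s0 u0) : r0 =
    ((f x1 - f x2) / (x1 - x2) - (f x2 - f x3) / (x2 - x3)) / (x1 - x3).
  by rewrite /f /q; field; rewrite d12 d13 d23.
have rr : r = r' by rewrite (rE r s u) (rE r' s' u') /q h1 h2 h3.
have sE r0 s0 u0 (f := q r0 s0 u0) :
    s0 = (f x1 - f x2) / (x1 - x2) - r0 * (x1 + x2).
  by rewrite /f /q; field.
have ss : s = s' by rewrite (sE r s u) (sE r' s' u') /q h1 h2 rr.
by split=> //; move: h1; rewrite rr ss; apply: addrI.
Qed.

Lemma quadratic_hermite (r s u r' s' u' x1 x2 : rat) : x1 != x2 ->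
  r * x1 ^+ 2 + s * x1 + u = r' * x1 ^+ 2 + s' * x1 + u' ->
  2%:R * r * x1 + s = 2%:R * r' * x1 + s' ->
  r * x2 ^+ 2 + s * x2 + u = r' * x2 ^+ 2 + s' * x2 + u' ->
  [/\ r = r', s = s' & u = u'].
Proof.
move=> n12 h1 h1' h2.
have d12 : x1 - x2 != 0 by rewrite subr_eq0.
pose q r s u (x : rat) : rat := r * x ^+ 2 + s * x + u.
have rE r0 s0 u0 (f := q r0 s0 u0) : r0 =
    ((2%:R * r0 * x1 + s0) - (f x1 - f x2) / (x1 - x2)) / (x1 - x2).
  by rewrite /f /q; field.
have rr : r = r' by rewrite (rE r s u) (rE r' s' u') /q h1 h2 h1'.
have ss : s = s' by move: h1'; rewrite rr; apply: addrI.
by split=> //; move: h1; rewrite rr ss; apply: addrI.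
Qed.

Lemma oppt_add E P Q : addpt E (oppt P) (oppt Q) = oppt (addpt E P Q).
Proof.
case: P Q => [|x1 y1] [|x2 y2] //=.
case: eqVneq => [<-|n12] /=; last first.
  have d : x2 - x1 != 0 by rewrite subr_eq0 eq_sym.
  by rewrite /add_slope /=; congr Aff; field.
rewrite eqr_opp; case: eqVneq => // _; rewrite /add_slope /= mulrN invrN mulrN.
by rewrite sqrrN; congr Aff; ring.
Qed.

Lemma on_curve_abscissa E x y y' :
  on_curve E (Aff x y) -> on_curve E (Aff x y') -> y' = y \/ y' = - y.
Proof.
move=> /= <- /eqP; rewrite -subr_eq0 subr_sqr mulf_eq0 subr_eq0 addr_eq0.
by case/orP=> /eqP; [left|right].
Qed.

(** Both sums come from a parabola through (x3, y3) that is tangent to the curve at (x, y). These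
    conditions determine the parabola, hence its fourth intersection. *)
Lemma addpt_double_chord E x y x3 y3 :
  on_curve E (Aff x y) -> on_curve E (Aff x3 y3) -> x != x3 -> y != 0 ->
  addpt E (addpt E (Aff x y) (Aff x y)) (Aff x3 y3) <> Inf ->
  addpt E (addpt E (Aff x3 y3) (Aff x y)) (Aff x y) <> Inf ->
  addpt E (addpt E (Aff x y) (Aff x y)) (Aff x3 y3) =
  addpt E (addpt E (Aff x3 y3) (Aff x y)) (Aff x y).
Proof.
move=> c1 c3 n13 y0 nI1 nI2.
have n1 : Aff x y <> Aff x (- y).
  by case=> /eqP; rewrite eq_sym eqNr (negPf y0).
have n31 : Aff x3 y3 <> Aff x (- y) by case=> /eqP; rewrite eq_sym (negPf n13).
have n31' : Aff x y <> Aff x3 (- y3) by case=> /eqP; rewrite (negPf n13).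
have [r [s [u [x4 [r0 cp [h1 _ h3] ->]]]]] :=
  addpt3_coparabolic c1 c1 c3 n1 n31 n31 nI1.
have [r' [s' [u' [x4' [_ cp' [h3' _ h1'] ->]]]]] :=
  addpt3_coparabolic c3 c1 c1 n31' n31' n1 nI2.
have cp2 : coparabolic E r' s' u' x x x3 x4'.
  by case: cp' => p1 p2 p3 p4; split; rewrite -?p1 -?p2 -?p3 -?p4; ring.
have dr : 2%:R * r * x + s = 2%:R * r' * x + s'.
  have y20 : 2%:R * y != 0 by rewrite mulf_neq0.
  apply: (mulfI y20).
  by rewrite (coparabolic_double cp h1) (coparabolic_double cp2 h1').
have [rr ss uu] : [/\ r = r', s = s' & u = u'].
  by apply: (quadratic_hermite n13); rewrite -?h1 -?h3.
subst r' s' u'; suff -> : x4 = x4' by [].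
have rr0 : r ^+ 2 != 0 by rewrite expf_neq0.
case: cp cp2 => [p1 _ _ _] [p2 _ _ _]; apply: (@addrI _ (x + x + x3)).
by apply: (mulfI rr0); rewrite p1 p2.
Qed.

Lemma addpt_rotate0 E P Q R : elliptic E ->
  on_curve E P -> on_curve E Q -> on_curve E R ->
  addpt E (addpt E P Q) R = Inf -> addpt E (addpt E R Q) P = Inf.
Proof.
move=> ell cP cQ cR /addpt_eq0 -> //; last exact: on_curve_add.
have -> : addpt E (oppt (addpt E P Q)) Q = oppt P.
  have := oppt_add E (addpt E P Q) (oppt Q); rewrite opptK => ->; congr oppt.
  by rewrite (addptC cP cQ) addpt_neg_cancel.
by rewrite addptC ?addptN //; exact: oppt_on.
Qed.

(** Together with commutativity, this symmetry is associativity. Opposite points and infinite sums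
    are handled by cancellation, and P = R is trivial. Otherwise P and R have distinct abscissae, so
    at most two of the three points coincide, and interpolation, with at most one tangency,
    identifies the two parabolas. *)
Lemma addpt_rotate E P Q R : elliptic E ->
  on_curve E P -> on_curve E Q -> on_curve E R ->
  addpt E (addpt E P Q) R = addpt E (addpt E R Q) P.
Proof.
move=> ell cP cQ cR.
have [nI|] := eq_point_dec (addpt E (addpt E P Q) R) Inf.
  by rewrite nI addpt_rotate0.
have [nI'|] := eq_point_dec (addpt E (addpt E R Q) P) Inf.
  by rewrite nI' addpt_rotate0.
have [->//|nPR] := eq_point_dec P R.
have [PQ|nPQ] := eq_point_dec Q (oppt P).
  rewrite PQ addptN (addptC cR (oppt_on cP)) -[X in addpt _ _ X]opptK.
  by rewrite addpt_neg_cancel //; exact: oppt_on.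
have [RQ|nRQ] := eq_point_dec R (oppt Q).
  rewrite RQ (addptC (oppt_on cQ) cQ) addptN (addptC cP cQ).
  by rewrite addpt_neg_cancel.
have [RP|nRP] := eq_point_dec R (oppt P).
  rewrite RP addpt_neg_cancel // -[X in addpt _ _ X]opptK.
  by rewrite addpt_neg_cancel //; exact: oppt_on.
case: P Q R cP cQ cR nPR nPQ nRQ nRP => [|x1 y1] [|x2 y2] [|x3 y3] //;
  rewrite ?addpt_Inf // => c1 c2 c3 nPR nPQ nRQ nRP nI' nI.
- by rewrite addptC.
- by rewrite addptC.
- by rewrite addptC.
have n13 : x1 != x3.
  apply/eqP => x13; rewrite -x13 in c3 nPR nRP.
  by have [y13|y13] := on_curve_abscissa c1 c3; [apply: nPR|apply: nRP];
    rewrite y13.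
have y0 x y : Aff x y <> Aff x (- y) -> y != 0.
  by move=> h; apply/eqP => y0; apply: h; rewrite y0 oppr0.
case: (eqVneq x1 x2) => [x12|n12].
  rewrite -x12 in c2 nPQ nRQ nI nI' *.
  have [y12|y12] := on_curve_abscissa c1 c2; last by case: nPQ; rewrite y12.
  rewrite y12 in nPQ nI nI' *; apply: addpt_double_chord => //; exact: y0 nPQ.
case: (eqVneq x3 x2) => [x32|n32].
  rewrite -x32 in c2 nPQ nRQ nI nI' *.
  have [y32|y32] := on_curve_abscissa c2 c3; last by case: nRQ; rewrite y32.
  rewrite -y32 in nRQ nI nI' *; apply/esym; apply: addpt_double_chord => //.
    by rewrite eq_sym.
  exact: y0 nRQ.
have nQP : Aff x1 y1 <> Aff x2 (- y2) by case=> /eqP; rewrite (negPf n12).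
have nQR : Aff x2 y2 <> Aff x3 (- y3) by case=> /eqP; rewrite eq_sym (negPf n32).
have nPR' : Aff x1 y1 <> Aff x3 (- y3) by case=> /eqP; rewrite (negPf n13).
have [r [s [u [x4 [r0 [p _ _ _] [h1 h2 h3] ->]]]]] :=
  addpt3_coparabolic c1 c2 c3 nPQ nRP nRQ nI.
have [r' [s' [u' [x4' [_ [p' _ _ _] [h3' h2' h1'] ->]]]]] :=
  addpt3_coparabolic c3 c2 c1 nQR nPR' nQP nI'.
have [rr ss uu] : [/\ r = r', s = s' & u = u'].
  by apply: (quadratic_interp n12 n13); rewrite -?h1 -?h2 -?h3 // eq_sym.
subst r' s' u'; suff -> : x4 = x4' by [].
have rr0 : r ^+ 2 != 0 by rewrite expf_neq0.
apply: (@addrI _ (x1 + x2 + x3)); apply: (mulfI rr0); rewrite p -p'; ring.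
Qed.

Lemma addptA E P Q R : elliptic E ->
  on_curve E P -> on_curve E Q -> on_curve E R ->
  addpt E P (addpt E Q R) = addpt E (addpt E P Q) R.
Proof.
move=> ell cP cQ cR; rewrite addpt_rotate // (addptC cR cQ) addptC //.
exact: on_curve_add.
Qed.

Lemma mulpt_on E P n : on_curve E P -> on_curve E (mulpt E n P).
Proof. by move=> cP; elim: n => //= n; exact: on_curve_add. Qed.

Lemma mulptD E P m n : elliptic E -> on_curve E P ->
  mulpt E (m + n) P = addpt E (mulpt E m P) (mulpt E n P).
Proof.
move=> ell cP; elim: m => //= m IHm; rewrite -/(mulpt E m P) -addptA //.
- by rewrite -IHm.
- exact: mulpt_on.
- exact: mulpt_on.
Qed.

(** * Reduced forms and doubling *)

(** Unlike [lowest_form], the sign of e is free: the program divides by the absolute value of tau,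
    so its denominators may change sign. *)
Definition coprime_form (P : point) (m n e : int) : Prop :=
  [/\ P = Aff (m%:~R / e%:~R ^+ 2) (n%:~R / e%:~R ^+ 3),
      e != 0, coprimez m e & coprimez n e].

Lemma lowest_coprime_form P m n e : lowest_form P m n e -> coprime_form P m n e.
Proof.
by move=> [-> e1 /eqP cm /eqP cn]; split=> //; apply/eqP => e0; rewrite e0 in e1.
Qed.

(* For P = (m / e^2, n / e^3): x(2P) = dnum / (4 n^2 e^2), n^2 = cnum, and the
   tangent at P has slope tnum / (2 n e). *)
Definition dnum (E : curve) (m e : int) : int :=
  m ^+ 4 - 2%:R * cb E * m ^+ 2 * e ^+ 4 - 8%:R * cc E * m * e ^+ 6
  + (cb E ^+ 2 - 4%:R * ca E * cc E) * e ^+ 8.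

Definition cnum (E : curve) (m e : int) : int :=
  m ^+ 3 + ca E * m ^+ 2 * e ^+ 2 + cb E * m * e ^+ 4 + cc E * e ^+ 6.

Definition tnum (E : curve) (m e : int) : int :=
  3%:R * m ^+ 2 + 2%:R * ca E * m * e ^+ 2 + cb E * e ^+ 4.

(* Minus four times the discriminant of the cubic. *)
Definition bound (E : curve) : int :=
  4%:R * (4%:R * cb E ^+ 3 + 27%:R * cc E ^+ 2 + 4%:R * ca E ^+ 3 * cc E
          - ca E ^+ 2 * cb E ^+ 2 - 18%:R * ca E * cb E * cc E).

(** A Bezout identity between the numerator and the denominator of the duplication formula,
    homogenised in m and e^2. *)
Lemma dnum_cnum_bound E m e :
  4%:R * (3%:R * m ^+ 2 + 2%:R * ca E * m * e ^+ 2
          + (4%:R * cb E - ca E ^+ 2) * e ^+ 4) * dnum E m e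
  + (ca E * m ^+ 2 * e ^+ 2 - 3%:R * m ^+ 3 + 5%:R * cb E * m * e ^+ 4
     + (27%:R * cc E - 2%:R * ca E * cb E) * e ^+ 6) * (4%:R * cnum E m e)
  = bound E * e ^+ 12.
Proof. by rewrite /dnum /cnum /bound; ring. Qed.

(** Over [algC] the cubic splits, and the discriminant is the squared product of the differences of
    its roots. A repeated root would be the abscissa of a singular point with y = 0. *)
Lemma elliptic_bound_neq0 E : elliptic E -> bound E != 0.
Proof.
move=> ell; apply/eqP => b0.
pose a : algC := (ca E)%:~R; pose b : algC := (cb E)%:~R.
pose c : algC := (cc E)%:~R.
have D0 : 4%:R * b ^+ 3 + 27%:R * c ^+ 2 + 4%:R * a ^+ 3 * c
          - a ^+ 2 * b ^+ 2 - 18%:R * a * b * c = 0.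
  have n4 : 4%:R != 0 :> algC by rewrite pnatr_eq0.
  apply: (mulfI n4); rewrite mulr0 -[RHS](rmorph0 intr) -b0 /bound.
  by rewrite !(rmorph_nat, rmorphXn, rmorphM, rmorphB, rmorphD).
(* First a root x1 of f, then a root x2 of the quotient of f by X - x1; the third root follows from
   the sum of the roots. *)
have [x1 r1] := @solve_monicpoly algC 3 (nth 0 [:: - c; - b; - a]) isT.
have [x2 r2] := @solve_monicpoly algC 2
  (nth 0 [:: - (b + x1 * (a + x1)); - (a + x1)]) isT.
have {}r1 : x1 ^+ 3 = - (c + b * x1 + a * x1 ^+ 2).
  by rewrite r1 !big_ord_recl big_ord0 /= /bump /=; ring.
have {}r2 : x2 ^+ 2 = - (b + x1 * (a + x1) + (a + x1) * x2).
  by rewrite r2 !big_ord_recl big_ord0 /= /bump /=; ring.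
pose x3 := - (a + x1) - x2.
have aE : a = - (x1 + x2 + x3) by rewrite /x3; ring.
have bE : b = x1 * x2 + x1 * x3 + x2 * x3.
  have -> : b = - x2 ^+ 2 - (a + x1) * x2 - x1 * (a + x1) by rewrite r2; ring.
  by rewrite /x3; ring.
have cE : c = - (x1 * x2 * x3).
  have -> : c = - x1 ^+ 3 - b * x1 - a * x1 ^+ 2 by rewrite r1; ring.
  by rewrite bE aE; ring.
have sing x y : a = - (x + x + y) -> b = x * x + x * y + x * y ->
    c = - (x * x * y) -> False.
  move=> aE' bE' cE'; apply: (ell x 0); rewrite /singular_point /rhs /drhs.
  by rewrite -/a -/b -/c aE' bE' cE'; split; ring.
have : ((x1 - x2) * (x1 - x3) * (x2 - x3)) ^+ 2 = 0.
  by rewrite -[RHS]oppr0 -D0 aE bE cE; ring.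
move/eqP; rewrite expf_eq0 /= !mulf_eq0 !subr_eq0 -orbA.
case/or3P => /eqP e12.
- by apply: (sing x1 x3); rewrite ?aE ?bE ?cE -?e12; ring.
- by apply: (sing x1 x2); rewrite ?aE ?bE ?cE -?e12; ring.
- by apply: (sing x2 x1); rewrite ?aE ?bE ?cE -?e12; ring.
Qed.

Section Forms.
Variable E : curve.

Lemma on_curve_cnum P m n e :
  coprime_form P m n e -> on_curve E P -> n ^+ 2 = cnum E m e.
Proof.
move=> [-> e0 _ _] /=; rewrite /rhs => H.
have e0' : e%:~R != 0 :> rat by rewrite intr_eq0.
apply/eqP; rewrite -(eqr_int rat) /cnum; apply/eqP.
rewrite !(rmorphXn, rmorphM, rmorphD) /=.
have -> : n%:~R ^+ 2 = (n%:~R / e%:~R ^+ 3) ^+ 2 * e%:~R ^+ 6 :> rat by field.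
by rewrite H; field.
Qed.

Lemma coprime_dnum m e : coprimez m e -> coprimez (dnum E m e) e.
Proof.
move=> cme; have -> : dnum E m e = m ^+ 4 + ((cb E ^+ 2 - 4%:R * ca E * cc E) * e ^+ 7
   - 2%:R * cb E * m ^+ 2 * e ^+ 3 - 8%:R * cc E * m * e ^+ 5) * e.
  by rewrite /dnum; ring.
by rewrite coprimez_sym /coprimez addrC gcdzMDl -/(coprimez _ _) coprimezXr // coprimez_sym.
Qed.

Lemma dvdz_gcd_bound m n e d : coprimez m e -> n ^+ 2 = cnum E m e ->
  (d %| dnum E m e)%Z -> (d %| 4%:R * n ^+ 2)%Z -> (d %| bound E)%Z.
Proof.
move=> cme nE d1 d2.
have cde : coprimez d (e ^+ 12).
  apply: coprimezXr; have := coprime_dnum cme; case/dvdzP: d1 => k ->.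
  by rewrite coprimezMl => /andP[].
rewrite -(Gauss_dvdzl _ cde) -(dnum_cnum_bound E m e) -nE.
by rewrite rpredD // dvdz_mull.
Qed.

(** F is the quotient of the denominators and T is tau. Since x(2P) = [dnum] / (2 n e)^2 and m' is
    prime to e', e' divides 2 n e with quotient T. As [dnum] = m' T^2 is prime to e, so is T, whence
    e divides e'. The last equation, from the tangent line, lets the program compute n'. *)
Lemma coprime_form_double P m n e m' n' e' : on_curve E P ->
  coprime_form P m n e -> coprime_form (addpt E P P) m' n' e' ->
  exists T F, [/\ e' = F * e, 2%:R * n = T * F, dnum E m e = m' * T ^+ 2,
    coprimez m' F & T * n' = tnum E m e * (m * F ^+ 2 - m') - T * n * F ^+ 3].
Proof.
move=> cP fP fPP; have nE := on_curve_cnum fP cP.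
case: fP => DP e0 cme cne; case: fPP => DPP e'0 cme' cne'.
have e0r : e%:~R != 0 :> rat by rewrite intr_eq0.
have e'0r : e'%:~R != 0 :> rat by rewrite intr_eq0.
move: DPP; rewrite {}DP /= eqxx /= eq_sym eqNr.
case: eqVneq => // y0; rewrite /add_slope.
set a : rat := (ca E)%:~R.
set l := _ / _ => -[xE yE].
have n0 : n != 0 by apply: contraNneq y0 => ->; rewrite mul0r.
have n0r : n%:~R != 0 :> rat by rewrite intr_eq0.
have lE : l = (tnum E m e)%:~R / (2%:R * n%:~R * e%:~R).
  rewrite /l /drhs /tnum !(rmorph_nat, rmorphXn, rmorphM, rmorphD) /=.
  by field; rewrite n0r e0r.
have k1 : dnum E m e * e' ^+ 2 = m' * (2%:R * n * e) ^+ 2.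
  apply/eqP; rewrite -(eqr_int rat); apply/eqP.
  rewrite !(rmorph_nat, rmorphXn, rmorphM) /=.
  have -> : m'%:~R = m'%:~R / e'%:~R ^+ 2 * e'%:~R ^+ 2 :> rat by field.
  have -> : dnum E m e = tnum E m e ^+ 2 - 4%:R * (2%:R * m + ca E * e ^+ 2) * cnum E m e.
    by rewrite /dnum /tnum /cnum; ring.
  rewrite -nE -xE lE !(rmorph_nat, rmorphXn, rmorphM, rmorphB, rmorphD) /= -/a.
  by field; rewrite n0r e0r.
have /dvdzP[T TE] : (e' %| 2%:R * n * e)%Z.
  have : (e' ^+ 2 %| (2%:R * n * e) ^+ 2)%Z.
    have c2 : coprimez (e' ^+ 2) m' by rewrite coprimezXl // coprimez_sym.
    by rewrite -(Gauss_dvdzr _ c2) -k1 dvdz_mull.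
  by rewrite !dvdzE !abszX dvdn_pexp2r.
have AE : dnum E m e = m' * T ^+ 2.
  have e2 : e' ^+ 2 != 0 by rewrite expf_neq0.
  by apply: (mulIf e2); rewrite k1 TE; ring.
have /dvdzP[F FE] : (e %| e')%Z.
  have ceT : coprimez e T.
    have := coprime_dnum cme; rewrite AE coprimezMl coprimez_pexpl //.
    by case/andP=> _; rewrite coprimez_sym.
  by rewrite -(Gauss_dvdzr _ ceT) -TE dvdz_mull.
have nTF : 2%:R * n = T * F by apply: (mulIf e0); rewrite TE FE; ring.
exists T, F; split=> //.
  by move: cme'; rewrite FE coprimezMr => /andP[].
have TF0 : (T != 0) && (F != 0).
  by rewrite -negb_or -mulf_eq0 -nTF mulf_neq0.
have /andP[T0 F0] := TF0.
have T0r : T%:~R != 0 :> rat by rewrite intr_eq0.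
have F0r : F%:~R != 0 :> rat by rewrite intr_eq0.
have nTFr : n%:~R = T%:~R * F%:~R / 2%:R :> rat.
  by rewrite -rmorphM -nTF rmorphM /= rmorph_nat; field.
apply/eqP; rewrite -(eqr_int rat); apply/eqP.
rewrite !(rmorph_nat, rmorphXn, rmorphM, rmorphB) /=.
have -> : n'%:~R = n'%:~R / e'%:~R ^+ 3 * e'%:~R ^+ 3 :> rat by field.
rewrite -yE xE lE FE nTFr rmorphM /=.
by field; rewrite T0r F0r e0r.
Qed.

Definition tau_sq (m n e : int) : int := gcdz (dnum E m e) (4%:R * n ^+ 2).

(** Taking T^2 out of [dnum] and 4 n^2 leaves m' and F^2, which are coprime. *)
Lemma coprime_form_double_tau_sq P m n e m' n' e' : on_curve E P ->
  coprime_form P m n e -> coprime_form (addpt E P P) m' n' e' ->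
  exists T F, [/\ e' = F * e, 2%:R * n = T * F & T ^+ 2 = tau_sq m n e].
Proof.
move=> cP fP fPP.
have [T [F [eF nT AE cmF _]]] := coprime_form_double cP fP fPP.
exists T, F; split=> //; rewrite /tau_sq AE.
have -> : 4%:R * n ^+ 2 = T ^+ 2 * F ^+ 2 by rewrite -exprMn -nT; ring.
rewrite [m' * _]mulrC -mulz_gcdr.
have /eqP-> : coprimez m' (F ^+ 2) by rewrite coprimezXr.
by rewrite mulr1 abszE ger0_norm ?sqr_ge0.
Qed.

Lemma tau_sq_coprime m n e : coprimez m e -> coprimez (tau_sq m n e) e.
Proof.
move=> cme; have := coprime_dnum cme.
have /dvdzP[k ->] := dvdz_gcdl (dnum E m e) (4%:R * n ^+ 2).
by rewrite coprimezMl => /andP[].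
Qed.

Lemma tau_sq_bound m n e : coprimez m e -> n ^+ 2 = cnum E m e ->
  (tau_sq m n e %| bound E)%Z.
Proof.
by move=> cme nE; apply: (dvdz_gcd_bound cme nE); rewrite ?dvdz_gcdl ?dvdz_gcdr.
Qed.

(** * Divisibility at a prime and the kernels of reduction *)

Lemma primez_coprime (p : nat) z :
  prime p -> coprimez p%:Z z = ~~ (p%:Z %| z)%Z.
Proof. by move=> pp; rewrite coprimezE dvdzE prime_coprime. Qed.

(** Both arguments of the gcd are forms in m and e^2, of degrees 4 and 3. Multiplying by e^8 and e^6
    turns the congruence of abscissae into a congruence of their values. *)
Lemma tau_sq_congr (p d i : nat) m n e m' n' e' : coprimez p%:Z e ->
  n ^+ 2 = cnum E m e -> n' ^+ 2 = cnum E m' e' ->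
  (p%:Z ^+ d %| m' * e ^+ 2 - m * e' ^+ 2)%Z -> (i <= d)%N ->
  (p%:Z ^+ i %| tau_sq m n e)%Z -> (p%:Z ^+ i %| tau_sq m' n' e')%Z.
Proof.
move=> ce nE nE' /(dvdz_trans (dvdz_exp2l _ _)) h id; have {h}h := h _ id.
have cei k : coprimez (p%:Z ^+ i) (e ^+ k) by rewrite coprimezXl ?coprimezXr.
rewrite !dvdz_gcd nE nE' => /andP[h1 h2]; apply/andP; split.
  rewrite -(Gauss_dvdzl _ (cei 8)); set X := m * e' ^+ 2; set Y := m' * e ^+ 2.
  have -> : dnum E m' e' * e ^+ 8 = dnum E m e * e' ^+ 8 + (Y - X) *
      ((X + Y) * (X ^+ 2 + Y ^+ 2) - 2%:R * cb E * (e * e') ^+ 4 * (X + Y)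
       - 8%:R * cc E * (e * e') ^+ 6) by rewrite /dnum /X /Y; ring.
  by apply: rpredD; [exact: dvdz_mulr h1|exact: dvdz_mulr h].
rewrite -(Gauss_dvdzl _ (cei 6)); set X := m * e' ^+ 2; set Y := m' * e ^+ 2.
have -> : 4%:R * cnum E m' e' * e ^+ 6 = 4%:R * cnum E m e * e' ^+ 6 + (Y - X) *
    (4%:R * (X ^+ 2 + X * Y + Y ^+ 2 + ca E * (e * e') ^+ 2 * (X + Y)
       + cb E * (e * e') ^+ 4)) by rewrite /cnum /X /Y; ring.
by apply: rpredD; [exact: dvdz_mulr h2|exact: dvdz_mulr h].
Qed.

(* In E(Q_p), translation by a point of the r-th kernel of reduction moves the
   abscissa of a p-integral point by a multiple of p^r. *)
Lemma add_near_infinity (p r : nat) Q S m n e M N e2 m3 n3 e3 :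
  prime p -> (0 < r)%N -> on_curve E Q -> on_curve E S ->
  coprime_form Q m n e -> coprime_form S M N e2 ->
  coprime_form (addpt E Q S) m3 n3 e3 ->
  coprimez p%:Z e -> (p%:Z ^+ r %| e2)%Z ->
  coprimez p%:Z e3 /\ (p%:Z ^+ r %| m3 * e ^+ 2 - m * e3 ^+ 2)%Z.
Proof.
move=> pp r0 cQ cS fQ fS fQS ce pe2.
have nE := on_curve_cnum fQ cQ; have NE := on_curve_cnum fS cS.
case: fQ => DQ e0 cme _; case: fS => DS e20 cMe _; case: fQS => DQS e30 cme3 _.
have e0r : e%:~R != 0 :> rat by rewrite intr_eq0.
have e20r : e2%:~R != 0 :> rat by rewrite intr_eq0.
have e30r : e3%:~R != 0 :> rat by rewrite intr_eq0.
have pe2' : (p%:Z %| e2)%Z.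
  by apply: dvdz_trans pe2; rewrite -[X in (X %| _)%Z]expr1 dvdz_exp2l.
have cpM : coprimez p%:Z M.
  by rewrite coprimez_sym; case/dvdzP: pe2' cMe => k ->; rewrite coprimezMr => /andP[].
pose H := M * e ^+ 2 - m * e2 ^+ 2.
have cpH : coprimez p%:Z H.
  rewrite /H; case/dvdzP: pe2' => k ->.
  have -> : M * e ^+ 2 - m * (k * p%:Z) ^+ 2 = - m * k ^+ 2 * p%:Z * p%:Z + M * e ^+ 2.
    by ring.
  by rewrite /coprimez gcdzMDl -/(coprimez _ _) coprimezMr cpM coprimezXr.
have H0 : H != 0.
  apply: contraTneq cpH => ->; rewrite primez_coprime // dvdz0 //.
have H0r : (M%:~R * e%:~R ^+ 2 - m%:~R * e2%:~R ^+ 2) != 0 :> rat.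
  by rewrite -!rmorphXn -!rmorphM -rmorphB intr_eq0.
(* Expanding the chord formula with the curve equation gives x(Q + S) - x(Q) = e2 K / (e H)^2; the
   terms without a factor e2 cancel. *)
pose K := e ^+ 2 * e2 * M * tnum E m e +
  e2 ^+ 3 * (cb E * m * e ^+ 4 + 2%:R * cc E * e ^+ 6 - m ^+ 3) - 2%:R * N * n * e ^+ 3.
have key : (m3 * e ^+ 2 - m * e3 ^+ 2) * H ^+ 2 = e2 * K * e3 ^+ 2.
  move: DQS; rewrite DQ DS /=; case: eqVneq => [xE|_] /=.
    case/eqP: H0r; move: xE => /(congr1 (fun z => z * (e%:~R ^+ 2 * e2%:~R ^+ 2))).
    have -> : m%:~R / e%:~R ^+ 2 * (e%:~R ^+ 2 * e2%:~R ^+ 2) = m%:~R * e2%:~R ^+ 2 :> rat by field.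
    by move=> ->; field.
  case=> xE _; apply/eqP; rewrite -(eqr_int rat); apply/eqP.
  rewrite /H /K /tnum !(rmorph_nat, rmorphXn, rmorphM, rmorphB, rmorphD) /=.
  have -> : m3%:~R = m3%:~R / e3%:~R ^+ 2 * e3%:~R ^+ 2 :> rat by field.
  have l2 : ((N%:~R / e2%:~R ^+ 3 - n%:~R / e%:~R ^+ 3) /
      (M%:~R / e2%:~R ^+ 2 - m%:~R / e%:~R ^+ 2)) ^+ 2 =
      ((cnum E M e2)%:~R * e%:~R ^+ 6 + (cnum E m e)%:~R * e2%:~R ^+ 6
       - 2%:R * N%:~R * n%:~R * e%:~R ^+ 3 * e2%:~R ^+ 3) /
      ((e%:~R * e2%:~R) ^+ 2 * (M%:~R * e%:~R ^+ 2 - m%:~R * e2%:~R ^+ 2) ^+ 2) :> rat.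
    rewrite -NE -nE !rmorphXn /=; field.
    by rewrite H0r e0r e20r.
  rewrite -xE l2 /cnum !(rmorph_nat, rmorphXn, rmorphM, rmorphB, rmorphD) /=.
  by field; rewrite H0r e0r e20r.
have cpr : coprimez (p%:Z ^+ r) (H ^+ 2) by rewrite coprimezXl ?coprimezXr.
have dv : (p%:Z ^+ r %| m3 * e ^+ 2 - m * e3 ^+ 2)%Z.
  by rewrite -(Gauss_dvdzl _ cpr) key !dvdz_mulr.
split=> //; rewrite primez_coprime //; apply/negP => pe3.
have cpm3 : coprimez p%:Z m3.
  by rewrite coprimez_sym; case/dvdzP: pe3 cme3 => k ->; rewrite coprimezMr => /andP[].
have : coprimez p%:Z (m3 * e ^+ 2) by rewrite coprimezMr cpm3 coprimezXr.
rewrite primez_coprime // => /negP[].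
have -> : m3 * e ^+ 2 = (m3 * e ^+ 2 - m * e3 ^+ 2) + m * e3 ^+ 2 by ring.
rewrite rpredD //; last by rewrite dvdz_mull // dvdz_exp.
by apply: dvdz_trans dv; rewrite -[X in (X %| _)%Z]expr1 dvdz_exp2l.
Qed.

(** For p-adic valuations, 4d <= 2 v(z) + v(y) and v(y) <= d give 2 v(z) >= 3d. *)
Lemma pfactor_dvdz_cancel (p d : nat) (z y : int) : prime p ->
  (p%:Z ^+ (4 * d) %| z ^+ 2 * y)%Z -> ~~ (p%:Z ^+ d.+1 %| y)%Z ->
  (p%:Z ^+ d %| z)%Z.
Proof.
move=> pp; case: (eqVneq z 0) => [-> //|z0]; case: (eqVneq y 0) => [->|y0].
  by rewrite dvdz0.
rewrite !dvdzE !abszX abszM abszX /= !pfactor_dvdn ?muln_gt0 ?expn_gt0 ?absz_gt0 ?z0 ?y0 //.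
rewrite lognM ?expn_gt0 ?absz_gt0 ?z0 ?y0 // lognX; lia.
Qed.

(* Two points congruent modulo p^(2d) and not too close to a 2-torsion point
   differ by a point of the d-th kernel of reduction. *)
Lemma sub_near_infinity (p d : nat) Q Q' m n e m' n' e' M N e2 :
  prime p -> (0 < d)%N ->
  coprime_form Q m n e -> coprime_form Q' m' n' e' ->
  coprime_form (addpt E Q' (oppt Q)) M N e2 ->
  m' * e ^+ 2 != m * e' ^+ 2 ->
  coprimez p%:Z e -> ~~ (p%:Z ^+ d.+1 %| 4%:R * n ^+ 2)%Z ->
  (p%:Z ^+ (2 * d) %| m' - m)%Z -> (p%:Z ^+ (2 * d) %| n' - n)%Z ->
  (p%:Z ^+ (2 * d) %| e' - e)%Z -> (p%:Z ^+ d %| e2)%Z.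
Proof.
move=> pp d0 [DQ e0 _ _] [DQ' e'0 _ _] [DS e20 _ _] nx ce nn hm hn he.
have e0r : e%:~R != 0 :> rat by rewrite intr_eq0.
have e'0r : e'%:~R != 0 :> rat by rewrite intr_eq0.
have e20r : e2%:~R != 0 :> rat by rewrite intr_eq0.
(* The chord through Q' and -Q has slope J / (e e' I), so x(Q' - Q) = Y / (e e' I)^2. Here I is
   divisible by p^(2d) and Y by at most p^d, so the denominator keeps a power of p. *)
pose I := m' * e ^+ 2 - m * e' ^+ 2.
pose J := n' * e ^+ 3 + n * e' ^+ 3.
pose Y := J ^+ 2 - I ^+ 2 * (ca E * e ^+ 2 * e' ^+ 2 + m * e' ^+ 2 + m' * e ^+ 2).
have I0r : m'%:~R * e%:~R ^+ 2 - m%:~R * e'%:~R ^+ 2 != 0 :> rat.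
  by rewrite -!rmorphXn -!rmorphM -rmorphB intr_eq0 subr_eq0.
have key : M * (e * e' * I) ^+ 2 = e2 ^+ 2 * Y.
  move: DS; rewrite DQ DQ' /=; case: eqVneq => [xE|_] /=.
    case/eqP: I0r; move: xE => /(congr1 (fun z => z * (e%:~R ^+ 2 * e'%:~R ^+ 2))).
    have -> : m'%:~R / e'%:~R ^+ 2 * (e%:~R ^+ 2 * e'%:~R ^+ 2) = m'%:~R * e%:~R ^+ 2 :> rat by field.
    by move=> ->; field.
  case=> xE _; apply/eqP; rewrite -(eqr_int rat); apply/eqP.
  rewrite /Y /I /J !(rmorph_nat, rmorphXn, rmorphM, rmorphB, rmorphD) /=.
  have -> : M%:~R = M%:~R / e2%:~R ^+ 2 * e2%:~R ^+ 2 :> rat by field.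
  rewrite -xE; field.
  have -> : m%:~R * e'%:~R ^+ 2 + - m'%:~R * e%:~R ^+ 2 =
    - (m'%:~R * e%:~R ^+ 2 - m%:~R * e'%:~R ^+ 2) :> rat by ring.
  by rewrite oppr_eq0 I0r e0r e'0r.
have pI : (p%:Z ^+ (2 * d) %| I)%Z.
  have -> : I = (m' - m) * e ^+ 2 - m * (e' + e) * (e' - e) by rewrite /I; ring.
  by rewrite rpredB ?(dvdz_mull _ he) ?(dvdz_mulr _ hm).
apply: (@pfactor_dvdz_cancel p d e2 Y) => //.
  rewrite -key exprMn mulrA dvdz_mull //.
  have -> : (4 * d = 2 * d * 2)%N by lia.
  by rewrite exprM dvdz_exp2r.
(* As d + 1 <= 2d, the congruences give Y = J^2 = 4 n^2 e^6 modulo p^(d+1). *)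
apply: contra nn => pY.
have cp6 : coprimez (p%:Z ^+ d.+1) (e ^+ 6) by rewrite coprimezXl ?coprimezXr.
rewrite -(Gauss_dvdzl _ cp6).
have -> : 4%:R * n ^+ 2 * e ^+ 6 = Y
    + I ^+ 2 * (ca E * e ^+ 2 * e' ^+ 2 + m * e' ^+ 2 + m' * e ^+ 2)
    - (J + 2%:R * n * e ^+ 3) *
      ((n' - n) * e ^+ 3 + n * (e' ^+ 2 + e' * e + e ^+ 2) * (e' - e)).
  by rewrite /Y /J; ring.
have hd z : (p%:Z ^+ (2 * d) %| z)%Z -> (p%:Z ^+ d.+1 %| z)%Z.
  by apply: dvdz_trans; rewrite dvdz_exp2l //; lia.
apply: rpredB.
  by apply: rpredD => //; rewrite dvdz_mulr // dvdz_exp // hd.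
apply: dvdz_mull; apply: hd; apply: rpredD; first exact: dvdz_mulr hn.
exact: dvdz_mull he.
Qed.
End Forms.

(** * Periodicity *)

Lemma coprime_form_opp P m n e :
  coprime_form P m n e -> coprime_form (oppt P) m (- n) e.
Proof.
by move=> [-> e0 c1 c2]; split; rewrite //= ?rmorphN ?mulNr // coprimez_sym coprimezN coprimez_sym.
Qed.

Lemma coprime_form_exists E P : on_curve E P -> P <> Inf ->
  exists m n e, coprime_form P m n e.
Proof.
case: P => // x y cP _; have [m [n [e f]]] := lowest_form_exists cP.
by exists m, n, e; exact: lowest_coprime_form.
Qed.

Section DoublingSequence.
Variables (E : curve) (P : point) (m n e : nat -> int).
Hypotheses (ell : elliptic E) (cP : on_curve E P) (oP : infinite_order E P).
Hypothesis forms : forall k, coprime_form (mulpt E (2 ^ k) P) (m k) (n k) (e k).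

Local Notation Q k := (mulpt E (2 ^ k) P).
Local Notation g k := (tau_sq E (m k) (n k) (e k)).

Lemma mulpt_exp2S k : Q k.+1 = addpt E (Q k) (Q k).
Proof. by rewrite expnS mul2n -addnn mulptD. Qed.

Lemma form_cnum k : n k ^+ 2 = cnum E (m k) (e k).
Proof. exact: on_curve_cnum (forms k) (mulpt_on _ cP). Qed.

Lemma form_coprime k : coprimez (m k) (e k).
Proof. by case: (forms k). Qed.

Lemma form_step k : exists T F,
  [/\ e k.+1 = F * e k, 2%:R * n k = T * F & T ^+ 2 = g k].
Proof.
apply: (coprime_form_double_tau_sq (mulpt_on _ cP) (forms k)).
by rewrite -mulpt_exp2S; exact: forms.
Qed.

Lemma form_dvd k j : (e k %| e (k + j)%N)%Z.
Proof.
elim: j => [|j IHj]; rewrite ?addn0 ?dvdzz // addnS.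
by have [T [F [-> _ _]]] := form_step (k + j); exact: dvdz_mull.
Qed.

Lemma tau_sq_dvd_bound k : (g k %| bound E)%Z.
Proof. by apply: tau_sq_bound; [exact: form_coprime|exact: form_cnum]. Qed.

Lemma mulpt_neq i j : (0 < i)%N -> (0 < j)%N -> i != j ->
  mulpt E i P <> mulpt E j P.
Proof.
wlog ij : i j / (i < j)%N => [hw|] i0 j0 nij.
  have /orP[ij|ji] : (i < j)%N || (j < i)%N by rewrite -neq_ltn.
    exact: hw.
  by move=> h; apply: (hw j i ji j0 i0 _ (esym h)); rewrite eq_sym.
have -> : j = (i + (j - i))%N by lia.
have ji : (0 < j - i)%N by lia.
rewrite mulptD // => h; apply: (oP ji).
have ci := mulpt_on i cP; have cij := mulpt_on (j - i) cP.
by rewrite -(addpt_neg_cancel ell ci cij) -h addptN.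
Qed.

(** Equal abscissae mean Q_l = Q_k or Q_l = -Q_k; infinite order forbids both. *)
Lemma abscissa_neq k l : (k < l)%N -> m l * e k ^+ 2 != m k * e l ^+ 2.
Proof.
move=> kl; apply/eqP => h.
have ek : (e k)%:~R != 0 :> rat by case: (forms k) => _; rewrite intr_eq0.
have el : (e l)%:~R != 0 :> rat by case: (forms l) => _; rewrite intr_eq0.
have h2 i : (0 < 2 ^ i)%N by rewrite expn_gt0.
have h3 : (2 ^ k != 2 ^ l)%N by rewrite eqn_exp2l // neq_ltn kl.
have := mulpt_neq (h2 k) (h2 l) h3.
have : addpt E (Q k) (Q l) <> Inf.
  by rewrite -mulptD //; apply: oP; rewrite addn_gt0 h2.
have ck := mulpt_on (2 ^ k) cP; have cl := mulpt_on (2 ^ l) cP.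
case: (forms k) (forms l) ck cl => -> _ _ _ [-> _ _ _].
have -> : (m l)%:~R / (e l)%:~R ^+ 2 = (m k)%:~R / (e k)%:~R ^+ 2 :> rat.
  apply/eqP; rewrite eqr_div ?expf_neq0 //; apply/eqP.
  by rewrite -!rmorphXn -!rmorphM h.
set x := _ / _; move=> ck cl; have [->|->] := on_curve_abscissa ck cl => //.
by rewrite -/(oppt (Aff x ((n k)%:~R / (e k)%:~R ^+ 3))) addptN.
Qed.

(** * Comparison of 2^(k+j) P and 2^(l+j) P at one prime *)

Section Local.
Variables (p : nat) (k l : nat).
Hypotheses (pp : prime p) (kl : (k < l)%N).
Let d := logn p `|bound E|.
Hypothesis d0 : (0 < d)%N.
Hypotheses (hm : (p%:Z ^+ (2 * d) %| m l - m k)%Z)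
  (hn : (p%:Z ^+ (2 * d) %| n l - n k)%Z)
  (he : (p%:Z ^+ (2 * d) %| e l - e k)%Z).

(** This is 2^j (Q_l - Q_k), written as a positive multiple of P so that infinite order makes it
    affine. *)
Local Notation S j := (mulpt E (2 ^ (l + j) - 2 ^ (k + j)) P).

Lemma exp2_lt j : (2 ^ (k + j) < 2 ^ (l + j))%N.
Proof. by rewrite ltn_exp2l // ltn_add2r. Qed.

Lemma diff_on j : on_curve E (S j). Proof. exact: mulpt_on. Qed.

Lemma diff_form j : exists M N e2, coprime_form (S j) M N e2.
Proof.
by apply: coprime_form_exists (diff_on j) _; apply: oP; rewrite subn_gt0 exp2_lt.
Qed.

Lemma add_diff j : addpt E (Q (k + j)) (S j) = Q (l + j).
Proof. by rewrite -mulptD // subnKC // ltnW // exp2_lt. Qed.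

Lemma sub_diff j : addpt E (Q (l + j)) (oppt (S j)) = Q (k + j).
Proof.
rewrite -add_diff (addptC (mulpt_on _ cP) (diff_on j)).
by rewrite addpt_neg_cancel //; exact: mulpt_on.
Qed.

Lemma diff_double j : S j.+1 = addpt E (S j) (S j).
Proof. by rewrite -mulptD //; congr (mulpt E _ P); rewrite !addnS !expnS; lia. Qed.

(** Q_l - Q_k lies in the d-th kernel of reduction by the congruences, and doubling only multiplies
    the denominator by an integer. *)
Lemma diff_near_infinity j M N e2 :
  coprimez p%:Z (e k) -> ~~ (p%:Z ^+ d.+1 %| 4%:R * n k ^+ 2)%Z ->
  coprime_form (S j) M N e2 -> (p%:Z ^+ d %| e2)%Z.
Proof.
move=> ce nn; elim: j M N e2 => [|j IHj] M N e2 fS.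
  have fS' : coprime_form (addpt E (Q l) (oppt (Q k))) M N e2.
    have := add_diff 0; rewrite !addn0 in fS *; move=> <-.
    by rewrite addpt_neg_cancel //; exact: mulpt_on.
  apply: (sub_near_infinity pp d0 (forms k) (forms l) fS' _ ce nn hm hn he).
  exact: abscissa_neq.
have [M1 [N1 [e1 f1]]] := diff_form j; rewrite diff_double in fS.
have [T [F [-> _ _]]] := coprime_form_double_tau_sq (diff_on j) f1 fS.
exact/dvdz_mull/IHj/f1.
Qed.

Lemma coprime_e_congr : coprimez p%:Z (e k) = coprimez p%:Z (e l).
Proof.
have : (p%:Z %| e l - e k)%Z.
  apply: dvdz_trans he; rewrite -[X in (X %| _)%Z]expr1 dvdz_exp2l //; lia.
case/dvdzP => c h; have -> : e l = c * p%:Z + e k by rewrite -h; ring.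
by rewrite /coprimez gcdzMDl.
Qed.

(** In 4 n^2 = T^2 F^2 the factor T^2 divides [bound E], so it absorbs at most p^d; hence p divides
    F. *)
Lemma prime_dvd_next i : (p%:Z ^+ d.+1 %| 4%:R * n i ^+ 2)%Z -> (p%:Z %| e i.+1)%Z.
Proof.
have [T [F [-> nT TE]]] := form_step i.
have -> : 4%:R * n i ^+ 2 = T ^+ 2 * F ^+ 2 by rewrite -exprMn -nT; ring.
move=> h; apply: dvdz_mulr; apply/negbNE; rewrite -primez_coprime //.
apply/negP => cF; have cF2 : coprimez (p%:Z ^+ d.+1) (F ^+ 2).
  by rewrite coprimezXl ?coprimezXr.
move: h; rewrite (Gauss_dvdzl _ cF2) TE => /dvdz_trans /(_ (tau_sq_dvd_bound i)).
rewrite dvdzE abszX /= pfactor_dvdn ?absz_gt0 ?elliptic_bound_neq0 //.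
by rewrite ltnn.
Qed.

(** Either alternative makes the p-parts of the two values of tau equal: in the first both are
    trivial, in the second [tau_sq_congr] applies. *)
Lemma locally_close j :
  ((p%:Z %| e (k + j)%N)%Z /\ (p%:Z %| e (l + j)%N)%Z) \/
  [/\ coprimez p%:Z (e (k + j)%N), coprimez p%:Z (e (l + j)%N) &
   (p%:Z ^+ d %| m (l + j)%N * e (k + j)%N ^+ 2 - m (k + j)%N * e (l + j)%N ^+ 2)%Z].
Proof.
have [ck|nk] := boolP (coprimez p%:Z (e k)); last first.
  left; have nl := nk; rewrite coprime_e_congr in nl.
  rewrite primez_coprime // negbK in nk; rewrite primez_coprime // negbK in nl.
  by split; [apply: dvdz_trans nk _|apply: dvdz_trans nl _]; exact: form_dvd.
have cl : coprimez p%:Z (e l) by rewrite -coprime_e_congr.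
(* Divisibility of 4 n_k^2 by p^(d+1) affects denominators only from index k + 1 on, so j = 0 is
   read off the congruences. *)
case: j => [|j].
  right; rewrite !addn0; split=> //.
  apply: (@dvdz_trans (p%:Z ^+ (2 * d))); first by rewrite dvdz_exp2l //; lia.
  have -> : m l * e k ^+ 2 - m k * e l ^+ 2 =
    e k ^+ 2 * (m l - m k) - m k * (e l + e k) * (e l - e k) by ring.
  by apply: rpredB; [exact: dvdz_mull hm|exact: dvdz_mull he].
have [nn|nn] := boolP (p%:Z ^+ d.+1 %| 4%:R * n k ^+ 2)%Z.
  have nn' : (p%:Z ^+ d.+1 %| 4%:R * n l ^+ 2)%Z.
    have -> : 4%:R * n l ^+ 2 =
      4%:R * n k ^+ 2 + 4%:R * (n l + n k) * (n l - n k) by ring.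
    apply: rpredD => //; apply: dvdz_mull; apply: dvdz_trans hn.
    by rewrite dvdz_exp2l //; lia.
  left; rewrite !addnS -!addSn; split.
    exact: dvdz_trans (prime_dvd_next nn) (form_dvd _ _).
  exact: dvdz_trans (prime_dvd_next nn') (form_dvd _ _).
have [M [N [e2 fS]]] := diff_form j.+1.
have pe2 := diff_near_infinity ck nn fS.
have ck' i : on_curve E (Q i) by exact: mulpt_on.
have [cj|nj] := boolP (coprimez p%:Z (e (k + j.+1)%N)).
  right; have fl := forms (l + j.+1); rewrite -add_diff in fl.
  have [] := add_near_infinity pp d0 (ck' _) (diff_on _) (forms _) fS fl cj pe2.
  by split.
(* The mixed case is impossible: if Q_(l+j) were p-integral, adding -S would make Q_(k+j)
   p-integral. *)
left; split; first by rewrite primez_coprime // negbK in nj.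
apply/negbNE; rewrite -primez_coprime //; apply: contra nj => cl'.
have fk := forms (k + j.+1); rewrite -sub_diff in fk.
by have [] := add_near_infinity pp d0 (ck' _) (oppt_on (diff_on _)) (forms _)
  (coprime_form_opp fS) fk cl' pe2.
Qed.
End Local.

Lemma prime_ndvd_tau_sq p i j : prime p -> (0 < i)%N -> (p%:Z %| e j)%Z ->
  ~~ (p%:Z ^+ i %| g j)%Z.
Proof.
move=> pp i0 pe; apply/negP => h.
have : coprimez (g j) (e j) by apply: tau_sq_coprime; exact: form_coprime.
have : (p%:Z %| g j)%Z.
  by apply: dvdz_trans h; rewrite -[X in (X %| _)%Z]expr1 dvdz_exp2l.
case/dvdzP => c ->; rewrite coprimezMl => /andP[_].
by rewrite primez_coprime // pe.
Qed.

(** Equality is checked on prime powers. A prime not dividing [bound E] divides neither side; for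
    the others the square in the modulus supplies the exponent 2d. *)
Lemma tau_sq_shift k l j : (k < l)%N ->
  (bound E ^+ 2 %| m l - m k)%Z -> (bound E ^+ 2 %| n l - n k)%Z ->
  (bound E ^+ 2 %| e l - e k)%Z -> g (k + j)%N = g (l + j)%N.
Proof.
move=> kl hm hn he.
have b0 := elliptic_bound_neq0 ell.
have g0 i : g i != 0.
  by apply: contraNneq b0 => gi; have := tau_sq_dvd_bound i; rewrite gi dvd0z.
have gpos i : (0 < `|g i|)%N by rewrite absz_gt0.
have gabs i : g i = `|g i|%N%:Z by [].
have bd p i (d := logn p `|bound E|) t : prime p -> (p%:Z ^+ i %| g t)%Z -> (i <= d)%N.
  move=> pp /dvdz_trans /(_ (tau_sq_dvd_bound t)).
  by rewrite dvdzE abszX /= pfactor_dvdn ?absz_gt0.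
have loc p i : prime p -> (0 < i)%N ->
    (p%:Z ^+ i %| g (k + j)%N)%Z = (p%:Z ^+ i %| g (l + j)%N)%Z.
  move=> pp i0; have [d0|d0] := posnP (logn p `|bound E|).
    have no t : (p%:Z ^+ i %| g t)%Z = false.
      by apply: contraTF i0 => /(bd p i t pp); rewrite d0 leqn0 => /eqP->.
    by rewrite !no.
  have pw : (p%:Z ^+ (2 * logn p `|bound E|) %| bound E ^+ 2)%Z.
    by rewrite mulnC exprM dvdz_pexp2r // dvdzE abszX /= pfactor_dvdnn.
  have [[pk pl]|[ck cl h]] := locally_close pp kl d0 (dvdz_trans pw hm)
    (dvdz_trans pw hn) (dvdz_trans pw he) j.
    by rewrite (negPf (prime_ndvd_tau_sq pp i0 pk)) (negPf (prime_ndvd_tau_sq pp i0 pl)).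
  apply/idP/idP => hi; have id := bd _ _ _ pp hi.
    exact: tau_sq_congr ck (form_cnum _) (form_cnum _) h id hi.
  apply: tau_sq_congr cl (form_cnum _) (form_cnum _) _ id hi.
  by rewrite -opprB rpredN.
have dir a b : (forall p i, prime p -> (0 < i)%N ->
    (p%:Z ^+ i %| g a)%Z -> (p%:Z ^+ i %| g b)%Z) -> (`|g a| %| `|g b|)%N.
  move=> h; apply/dvdn_partP => // p; rewrite inE p_part => pg.
  have pp : prime p by move: pg; rewrite mem_primes => /and3P[].
  have := h p (logn p `|g a|) pp; rewrite logn_gt0 => /(_ pg).
  by rewrite !dvdzE !abszX /=; apply; exact: pfactor_dvdnn.
suff h : `|g (k + j)%N|%N = `|g (l + j)%N|%N by rewrite (gabs (k + j)%N) h.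
apply/eqP; rewrite eqn_dvd; apply/andP.
by split; apply: dir => p i pp i0; rewrite loc.
Qed.

(** The number of triples of residues modulo [bound E ^+ 2]. *)
Definition preperiod : nat := `|bound E ^+ 6|.

Lemma tau_sq_period k : (preperiod <= k)%N -> g (k + preperiod`!)%N = g k.
Proof.
move=> Nk; have b0 := elliptic_bound_neq0 ell.
pose W := (`|bound E| ^ 2)%N.
have W0 : (0 < W)%N by rewrite expn_gt0 absz_gt0 b0.
have WE : bound E ^+ 2 = W%:Z.
  by rewrite /W -abszX abszE ger0_norm ?sqr_ge0.
have NE : preperiod = (W * W * W)%N by rewrite /preperiod abszX /W; ring.
pose res (z : int) : 'I_W.-1.+1 := inord `|(z %% W)%Z|.
have resP z z' : res z = res z' -> (bound E ^+ 2 %| z - z')%Z.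
  have lt z1 : (`|(z1 %% W)%Z| < W.-1.+1)%N.
    have := ltz_pmod z1 (_ : 0 < W%:Z); rewrite prednK // ltz_nat => /(_ W0).
    by rewrite -[X in X < _]gez0_abs ?modz_ge0 // eqz_nat -lt0n.
  move=> /(congr1 (@nat_of_ord _)); rewrite !inordK // => h.
  have {}h : (z %% W)%Z = (z' %% W)%Z.
    by rewrite -[LHS]gez0_abs ?h ?gez0_abs // modz_ge0 // eqz_nat -lt0n.
  by rewrite WE -eqz_mod_dvd; apply/eqP.
(* There is one more index than residue triples, so two indices i < j share a triple. *)
pose f (i : 'I_preperiod.+1) := (res (m i), res (n i), res (e i)).
have /injectivePn[i [j nij [hm hn he]]] : ~~ injectiveb f.
  apply/negP => /injectiveP /leq_card.
  by rewrite !card_prod !card_ord NE prednK // ltnn.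
wlog ij : i j nij hm hn he / (i < j)%N.
  move=> hw; case: (ltngtP i j) (nij) => [ij _|ji _|/val_inj->]; last by rewrite eqxx.
    exact: hw hm hn he ij.
  by apply: (hw j i) => //; rewrite eq_sym.
have sh t : g (i + t)%N = g (j + t)%N.
  by apply: tau_sq_shift => //; apply: resP.
have sh2 t c : (i <= t)%N -> g (t + c * (j - i))%N = g t.
  move=> it; elim: c => [|c IHc]; first by rewrite addn0.
  rewrite -IHc mulSn; set u := (c * (j - i))%N.
  have := sh (t + u - i)%N; have -> : (i + (t + u - i) = t + u)%N by lia.
  by move=> ->; congr (tau_sq E (m _) (n _) (e _)); lia.
have lj := ltn_ord j.
(* The period j - i is unknown but at most N, so it divides N!. *)
have /dvdnP[c ->] : (j - i %| preperiod`!)%N by apply: dvdn_fact; lia.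
by apply: sh2; lia.
Qed.

Lemma norm_tau k : exists t : int,
  [/\ 0 < t, `|tau n e k.+1| = t%:~R & t ^+ 2 = g k].
Proof.
have [T [F [eF nT TE]]] := form_step k.
have ek : (e k)%:~R != 0 :> rat by case: (forms k) => _; rewrite intr_eq0.
have : e k.+1 != 0 by case: (forms k.+1).
rewrite eF mulf_eq0 negb_or => /andP[F0 _].
have F0r : F%:~R != 0 :> rat by rewrite intr_eq0.
have nTr : 2%:R * (n k)%:~R = T%:~R * F%:~R :> rat.
  by rewrite -rmorphM -nT rmorphM /= rmorph_nat.
exists `|T|; split; last by rewrite real_normK ?num_real.
  rewrite normr_gt0; apply: contraNneq (elliptic_bound_neq0 ell) => T0.
  by have := tau_sq_dvd_bound k; rewrite -TE T0 expr0n dvd0z.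
rewrite intr_norm; congr `|_|; rewrite /tau /fermat /= eF nTr rmorphM /=.
by field; rewrite F0r ek.
Qed.
End DoublingSequence.

(** * The algorithm *)

(** Coprime forms differ only by the signs of n and e, which [tau_sq] does not see. The forms
    computed by the program can thus replace the given ones. *)
Lemma coprime_form_uniq E P m n e m' n' e' : on_curve E P ->
  coprime_form P m n e -> coprime_form P m' n' e' ->
  [/\ m = m', n ^+ 2 = n' ^+ 2 & e ^+ 2 = e' ^+ 2].
Proof.
move=> cP f f'; have nE := on_curve_cnum f cP; have nE' := on_curve_cnum f' cP.
case: f f' => [-> e0 cme _] [[xE _] e'0 cme' _].
have h : m * e' ^+ 2 = m' * e ^+ 2.
  apply/eqP; rewrite -(eqr_int rat) !(rmorphXn, rmorphM) /=.
  by rewrite -eqr_div ?expf_neq0 ?intr_eq0 // xE.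
have ee : e ^+ 2 = e' ^+ 2.
  suff /eqP : `|e|%N == `|e'|%N.
    by move=> h'; rewrite -[e ^+ 2]real_normK ?num_real // -abszE h' abszE real_normK ?num_real.
  have d1 : (e ^+ 2 %| e' ^+ 2)%Z.
    have c : coprimez (e ^+ 2) m by rewrite coprimezXl // coprimez_sym.
    by rewrite -(Gauss_dvdzr _ c) h dvdz_mull.
  have d2 : (e' ^+ 2 %| e ^+ 2)%Z.
    have c : coprimez (e' ^+ 2) m' by rewrite coprimezXl // coprimez_sym.
    by rewrite -(Gauss_dvdzr _ c) -h dvdz_mull.
  by rewrite !dvdz_pexp2r // in d1 d2; rewrite eqn_dvd; apply/andP.
have mm : m = m'.
  have e20 : e ^+ 2 != 0 by rewrite expf_neq0.
  by apply: (mulIf e20); rewrite -h ee.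
split=> //; rewrite nE nE' /cnum -mm.
have -> : e ^+ 4 = (e ^+ 2) ^+ 2 by ring.
have -> : e ^+ 6 = (e ^+ 2) ^+ 3 by ring.
by rewrite ee; ring.
Qed.

Lemma tau_sq_uniq E P m n e m' n' e' : on_curve E P ->
  coprime_form P m n e -> coprime_form P m' n' e' ->
  tau_sq E m n e = tau_sq E m' n' e'.
Proof.
move=> cP f f'; have [<- nn ee] := coprime_form_uniq cP f f'.
rewrite /tau_sq nn; congr gcdz; rewrite /dnum.
have -> : e ^+ 4 = (e ^+ 2) ^+ 2 by ring.
have -> : e ^+ 6 = (e ^+ 2) ^+ 3 by ring.
have -> : e ^+ 8 = (e ^+ 2) ^+ 4 by ring.
by rewrite ee; ring.
Qed.

(** The equations of [coprime_form_double] are solved for the new triple with t, the absolute value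
    of T, in place of T. *)
Lemma coprime_form_next E P m n e t : on_curve E P ->
  coprime_form P m n e -> addpt E P P <> Inf ->
  0 < t -> t ^+ 2 = tau_sq E m n e ->
  let F := (2%:R * n %/ t)%Z in let m' := (dnum E m e %/ t ^+ 2)%Z in
  coprime_form (addpt E P P) m'
    ((tnum E m e * (m * F ^+ 2 - m') - t * n * F ^+ 3) %/ t)%Z (F * e).
Proof.
move=> cP f nI t0 tE /=; have cPP := on_curve_add cP cP.
have [m' [n' [e' f']]] := coprime_form_exists cPP nI.
have [T [F [eF nT AE _ n'E]]] := coprime_form_double cP f f'.
have [T' [F' [eF' nT' T'E]]] := coprime_form_double_tau_sq cP f f'.
have FF : F' = F.
  by case: f => _ e0 _ _; apply: (mulIf e0); rewrite -eF -eF'.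
have F0 : F != 0 by case: f' => _ + _ _; rewrite eF mulf_eq0 negb_or => /andP[].
have TT : T' = T by apply: (mulIf F0); rewrite -nT nT' FF.
have t0' : t != 0 by rewrite gt_eqF.
rewrite TT -tE in T'E; have t2 : t ^+ 2 != 0 by rewrite expf_neq0.
rewrite AE T'E mulzK // nT.
(* If T = -t, the computed n' and e' both change sign, which leaves the point unchanged. *)
move/eqP: T'E; rewrite eqf_sqr => /orP[]/eqP TE; rewrite TE in n'E *.
  by rewrite [t * F]mulrC mulzK // -n'E [t * n']mulrC mulzK // -eF.
have -> : - t * F = - F * t by ring.
rewrite mulzK // sqrrN.
have -> : tnum E m e * (m * F ^+ 2 - m') - t * n * (- F) ^+ 3 = - n' * t.
  transitivity (tnum E m e * (m * F ^+ 2 - m') - - t * n * F ^+ 3); first by ring.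
  by rewrite -n'E; ring.
rewrite mulzK // mulNr -eF; case: f' => -> e'0 c1 c2.
split; rewrite ?oppr_eq0 ?coprimezN //.
  have e'0r : e'%:~R != 0 :> rat by rewrite intr_eq0.
  by rewrite !rmorphN /=; congr Aff; field.
by rewrite coprimez_sym coprimezN coprimez_sym.
Qed.

(** * Total-correctness rules for programs with output *)

Definition computes (c : prog) (s : store) (o : seq int) (R : store -> Prop) :=
  exists2 s', exec c s s' o & R s'.

Lemma computes_seq c1 c2 s o1 o2 (R1 R2 : store -> Prop) :
  computes c1 s o1 R1 -> (forall s', R1 s' -> computes c2 s' o2 R2) ->
  computes (Seq c1 c2) s (o1 ++ o2) R2.
Proof.
move=> [s1 x1 r1] /(_ _ r1) [s2 x2 r2]; exists s2 => //; exact: exec_seq x1 x2.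
Qed.

Lemma computes_assign i t s c o R :
  computes c (upd s i (eval s t)) o R -> computes (Seq (Assign i t) c) s o R.
Proof.
by move=> [s1 x1 r1]; exists s1 => //; exact: exec_seq (exec_assign s i t) x1.
Qed.

(** The iteration count K is fixed in advance, which gives termination; invariant and output are
    indexed by the iteration. *)
Lemma computes_while t c K (I : nat -> store -> Prop) (o : nat -> seq int) s :
  (forall k s, (k < K)%N -> I k s ->
     0 < eval s t /\ computes c s (o k) (I k.+1)) ->
  (forall s, I K s -> eval s t <= 0) -> I 0%N s ->
  computes (While t c) s (flatten [seq o k | k <- iota 0 K]) (I K).
Proof.
move=> step stop I0; have : forall j k s', (k + j = K)%N -> I k s' ->
    computes (While t c) s' (flatten [seq o i | i <- iota k j]) (I K).
  elim=> [|j IHj] k s' kj Ik.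
    rewrite addn0 in kj; rewrite kj in Ik.
    by exists s' => //; apply: exec_while_done; exact: stop.
  have kK : (k < K)%N by rewrite -kj addnS ltnS leq_addr.
  have [pos [s1 x1 r1]] := step _ _ kK Ik.
  have [|s2 x2 r2] := IHj k.+1 s1 _ r1; first by rewrite addSnnS.
  by exists s2 => //; exact: exec_while_step pos x1 x2.
by apply.
Qed.

Definition sqE (t : expr) := Mul t t.
Definition cubeE (t : expr) := Mul t (sqE t).
Definition numE (n : nat) := Cst n%:Z.

Definition dnumE (a b c m e : expr) : expr :=
  Add (Defs.Sub (Defs.Sub (sqE (sqE m)) (Mul (Mul (Mul (numE 2) b) (sqE m)) (sqE (sqE e))))
           (Mul (Mul (Mul (numE 8) c) m) (cubeE (sqE e))))
      (Mul (Defs.Sub (sqE b) (Mul (Mul (numE 4) a) c)) (sqE (sqE (sqE e)))).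

Definition tnumE (a b m e : expr) : expr :=
  Add (Add (Mul (numE 3) (sqE m)) (Mul (Mul (Mul (numE 2) a) m) (sqE e)))
      (Mul b (sqE (sqE e))).

Definition boundE (a b c : expr) : expr :=
  Mul (numE 4)
   (Defs.Sub (Defs.Sub (Add (Add (Mul (numE 4) (cubeE b)) (Mul (numE 27) (sqE c)))
                  (Mul (Mul (numE 4) (cubeE a)) c))
             (Mul (sqE a) (sqE b)))
        (Mul (Mul (Mul (numE 18) a) b) c)).

(* Registers: 0, 1, 2 hold a, b, c and 3, 5, 6 the coordinates m, n, e of the
   current point 2^k P; 7 the square of [bound E], 8 the preperiod, 9 its
   factorial, 10 a loop counter, 11 the current tau, 12 the next m and 13 the
   quotient of successive denominators. *)
(* Descends from a number at least tau to the largest t such that t^2 divides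
   both the numerator and the denominator of x(2^(k+1) P). *)
Definition search_tau : prog :=
  While (Add (Mod (Var 12) (sqE (Var 11)))
             (Mod (Mul (numE 4) (sqE (Var 5))) (sqE (Var 11))))
        (Assign 11 (Defs.Sub (Var 11) (numE 1))).

(** The new n needs the old m, n and e, so registers 3 and 6 are overwritten only after register
    5. *)
Definition advance : prog :=
  Seq (Assign 12 (Div (Var 12) (sqE (Var 11))))
  (Seq (Assign 13 (Div (Mul (numE 2) (Var 5)) (Var 11)))
  (Seq (Assign 5
     (Div (Defs.Sub (Mul (tnumE (Var 0) (Var 1) (Var 3) (Var 6))
                    (Defs.Sub (Mul (Var 3) (sqE (Var 13))) (Var 12)))
               (Mul (Mul (Var 11) (Var 5)) (cubeE (Var 13))))
          (Var 11)))
  (Seq (Assign 3 (Var 12))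
  (Seq (Assign 6 (Mul (Var 13) (Var 6)))
  (Seq (Assign 10 (Defs.Sub (Var 10) (numE 1)))
       Skip))))).

(** The search starts at the square of [bound E], which is positive whatever the sign of [bound E]
    and at least tau, as tau^2 divides [bound E]. *)
Definition doubling_step : prog :=
  Seq (Assign 12 (dnumE (Var 0) (Var 1) (Var 2) (Var 3) (Var 6)))
  (Seq (Assign 11 (Var 7))
  (Seq search_tau
  (Seq (Print (Var 11)) advance))).

Definition factorial_loop : prog :=
  While (Var 10)
    (Seq (Assign 9 (Mul (Var 9) (Var 10)))
    (Seq (Assign 10 (Defs.Sub (Var 10) (numE 1))) Skip)).

(** Registers 4 and 6 initially hold the denominators e^2 and e^3, whose quotient is e; m and n are
    already in place. The output is N, then N preperiodic values and one full cycle of N! values. *)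
Definition tau_prog : prog :=
  Seq (Assign 6 (Div (Var 6) (Var 4)))
  (Seq (Assign 7 (sqE (boundE (Var 0) (Var 1) (Var 2))))
  (Seq (Assign 8 (cubeE (Var 7)))
  (Seq (Assign 9 (numE 1))
  (Seq (Assign 10 (Var 8))
  (Seq factorial_loop
  (Seq (Assign 10 (Add (Var 8) (Var 9)))
  (Seq (Print (Var 8))
       (While (Var 10) doubling_step)))))))).

Lemma computes_factorial s N : s 9%N = 1 -> s 10%N = N%:Z ->
  computes factorial_loop s [::] (fun s' =>
    s' 9%N = N`!%:Z /\ forall i, (i < 9)%N -> s' i = s i).
Proof.
move=> s9 s10.
pose I k (s' : store) := [/\ s' 9%N * (N - k)`!%:Z = N`!%:Z, s' 10%N = (N - k)%N%:Z
  & forall i, (i < 9)%N -> s' i = s i].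
have [|||s' x [h _ r]] := @computes_while (Var 10)
  (Seq (Assign 9 (Mul (Var 9) (Var 10)))
    (Seq (Assign 10 (Defs.Sub (Var 10) (numE 1))) Skip)) N I (fun _ => [::]) s.
- move=> k s1 kN [h9 h10 hi] /=; rewrite h10; split; first by rewrite ltz_nat subn_gt0.
  do 2 apply: computes_assign.
  eexists; first exact: exec_skip.
  have NK : (N - k = (N - k.+1).+1)%N by lia.
  split; rewrite /upd /=.
  + by rewrite -h9 h10 NK factS PoszM mulrA.
  + by rewrite h10 NK; lia.
  + by move=> i i9; rewrite !ifF ?hi //; lia.
- by move=> s1 [_ /= -> _]; rewrite subnn.
- by split; rewrite ?subn0 // s9 mul1r.
exists s'; last by rewrite subnn fact0 mulr1 in h.
by move: x; elim: (iota 0 N).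
Qed.

(** The guard is a sum of two nonnegative remainders, so the loop stops exactly when both
    divisibilities hold, and on the way down t is the first such value. *)
Lemma computes_search s t : 0 < t -> t <= s 11%N ->
  (forall x, t <= x ->
     ((x ^+ 2 %| s 12%N)%Z && (x ^+ 2 %| 4%:R * s 5%N ^+ 2)%Z) = (x == t)) ->
  computes search_tau s [::] (fun s' =>
    s' 11%N = t /\ forall i, i != 11%N -> s' i = s i).
Proof.
move=> t0 tB div.
pose K := `|s 11%N - t|%N.
have KE : K%:Z = s 11%N - t by rewrite gez0_abs // subr_ge0.
pose I (k : nat) (s' : store) := s' 11%N = s 11%N - k%:Z /\ forall i, i != 11%N -> s' i = s i.
have [|||s' x [h r]] := @computes_while (Add (Mod (Var 12) (sqE (Var 11)))
             (Mod (Mul (numE 4) (sqE (Var 5))) (sqE (Var 11))))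
        (Assign 11 (Defs.Sub (Var 11) (numE 1))) K I (fun _ => [::]) s.
- move=> k s1 kK [h hi] /=; rewrite (hi 12%N) // (hi 5%N) // h -!expr2; set x := _ - _.
  have tx : t < x by rewrite /x; lia.
  have x20 : x ^+ 2 != 0 by rewrite expf_neq0 // gt_eqF // (lt_trans t0).
  split; last first.
    eexists; first exact: exec_assign.
    split; rewrite /upd /=; first by rewrite h; lia.
    by move=> i ni; rewrite (negPf ni) hi.
  rewrite lt_def addr_ge0 ?modz_ge0 // andbT paddr_eq0 ?modz_ge0 //.
  have := div x (ltW tx); rewrite (gt_eqF tx) => /negbT; apply: contra.
  by case/andP=> /eqP h1 /eqP h2; apply/andP; split; apply/dvdz_mod0P.
- move=> s1 [h hi] /=; rewrite (hi 12%N) // (hi 5%N) // h -!expr2 KE subKr.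
  have := div t (lexx t); rewrite eqxx => /andP[/dvdz_mod0P-> /dvdz_mod0P ->].
  by rewrite addr0.
- by split=> //; rewrite subr0.
exists s'; last by rewrite h KE subKr.
by move: x; elim: (iota 0 K).
Qed.

Definition holds_curve (E : curve) (s : store) : Prop :=
  [/\ s 0%N = ca E, s 1%N = cb E, s 2%N = cc E & s 7%N = bound E ^+ 2].

Lemma computes_advance E Q s t : on_curve E Q -> addpt E Q Q <> Inf ->
  holds_curve E s -> coprime_form Q (s 3%N) (s 5%N) (s 6%N) ->
  s 11%N = t -> s 12%N = dnum E (s 3%N) (s 6%N) ->
  0 < t -> t ^+ 2 = tau_sq E (s 3%N) (s 5%N) (s 6%N) ->
  computes advance s [::] (fun s' => [/\ holds_curve E s',
    coprime_form (addpt E Q Q) (s' 3%N) (s' 5%N) (s' 6%N)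
    & s' 10%N = s 10%N - 1]).
Proof.
move=> cQ nI [s0 s1 s2 s7] f s11 s12 t0 tE.
do 6 apply: computes_assign.
eexists; first exact: exec_skip.
split; [by split | | by []].
have := coprime_form_next cQ f nI t0 tE; rewrite /upd /= s11 s12 s0 s1.
by move=> h; rewrite -!expr2 -!(exprS _ 2) -!exprM; exact: h.
Qed.

Lemma computes_doubling_step E Q s t : elliptic E ->
  on_curve E Q -> addpt E Q Q <> Inf ->
  holds_curve E s -> coprime_form Q (s 3%N) (s 5%N) (s 6%N) ->
  0 < t -> t ^+ 2 = tau_sq E (s 3%N) (s 5%N) (s 6%N) ->
  computes doubling_step s [:: t] (fun s' => [/\ holds_curve E s',
    coprime_form (addpt E Q Q) (s' 3%N) (s' 5%N) (s' 6%N)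
    & s' 10%N = s 10%N - 1]).
Proof.
move=> ell cQ nI hs f t0 tE; have [s0 s1 s2 s7] := hs.
do 2 apply: computes_assign; set s' := upd _ 11 _.
have s'12 : s' 12%N = dnum E (s 3%N) (s 6%N).
  by rewrite /s' /upd /= s0 s1 s2 /dnum; ring.
have s'11 : s' 11%N = bound E ^+ 2 by rewrite /s' /upd /= s7.
have f0 := f; case: f0 => _ _ cme _; have nE := on_curve_cnum f cQ.
have b0 := elliptic_bound_neq0 ell.
have tb : t <= s' 11%N.
  have : (t ^+ 2 %| bound E)%Z by rewrite tE tau_sq_bound.
  rewrite s'11 -[bound E ^+ 2]real_normK ?num_real // -!abszE dvdzE => /dvdn_leq.
  rewrite absz_gt0 b0 => /(_ isT); rewrite abszX => h.
  nia.
rewrite -[[:: t]]/([::] ++ [:: t]).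
apply: (computes_seq (computes_search t0 tb _)).
  (* Both divisibilities together say that x^2 divides the gcd t^2, that is, x divides t; with x >=
     t > 0 this means x = t. *)
  move=> x tx; have -> : s' 5%N = s 5%N by []; rewrite s'12 -dvdz_gcd -/(tau_sq _ _ _ _) -tE.
  rewrite dvdz_pexp2r //; apply/idP/eqP => [|->]; last exact: dvdzz.
  by rewrite dvdzE => /dvdn_leq h; lia.
move=> s3 [s3t hi].
rewrite -[[:: t]]/([:: t] ++ [::]).
apply: (@computes_seq _ _ _ _ _ (fun s => s = s3)).
  by exists s3 => //; rewrite -s3t; exact: exec_print.
have E3 : [/\ s3 3%N = s 3%N, s3 5%N = s 5%N & s3 6%N = s 6%N] by rewrite !hi.
case: E3 => h3 h5 h6 _ ->.
have -> : s 10%N = s3 10%N by rewrite hi.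
apply: computes_advance => //; rewrite ?h3 ?h5 ?h6 //.
- by split; rewrite hi.
- by rewrite hi.
- by rewrite s3t.
- by rewrite s3t.
Qed.

Lemma input_form x y m n e : lowest_form (Aff x y) m n e ->
  coprime_form (Aff x y) (numq x) (numq y) (denq y %/ denq x)%Z.
Proof.
move=> f; have := lowest_coprime_form f; case: f => [[xE yE] e1 _ _] [_ e0 cm cn].
have c2 : coprime `|m| `|e ^+ 2| by rewrite -coprimezE coprimezXr.
have c3 : coprime `|n| `|e ^+ 3| by rewrite -coprimezE coprimezXr.
have e0' : 0 < e by rewrite (lt_le_trans _ e1).
have -> : numq x = m.
  by rewrite xE -rmorphXn coprimeq_num // gtr0_sg ?mul1r // exprn_gt0.
have -> : numq y = n.
  by rewrite yE -rmorphXn coprimeq_num // gtr0_sg ?mul1r // exprn_gt0.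
have -> : denq x = e ^+ 2.
  rewrite xE -rmorphXn coprimeq_den // expf_eq0 (gt_eqF e0') andbF.
  by rewrite ger0_norm // exprn_ge0 // ltW.
have -> : denq y = e ^+ 3.
  rewrite yE -rmorphXn coprimeq_den // expf_eq0 (gt_eqF e0') andbF.
  by rewrite ger0_norm // exprn_ge0 // ltW.
by rewrite exprS mulzK ?expf_neq0 // xE yE.
Qed.

(** * Period of the absolute values of tau, and the run of the program *)

Section MainTheorem.
Variables (E : curve) (P : point) (m n e : nat -> int).
Hypotheses (ell : elliptic E) (cP : on_curve E P) (oP : infinite_order E P).
Hypothesis df : doubling_forms E P m n e.

Local Notation Q k := (mulpt E (2 ^ k) P).
Local Notation N := (preperiod E).

Let forms k := lowest_coprime_form (df k).

Lemma norm_tau_int : exists u : nat -> int, forall k,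
  [/\ 0 < u k, `|tau n e k.+1| = (u k)%:~R & u k ^+ 2 = tau_sq E (m k) (n k) (e k)].
Proof.
exists (fun k => numq `|tau n e k.+1|) => k.
have [t [t0 tauE tE]] := norm_tau ell cP forms k.
by rewrite tauE numq_int.
Qed.

Lemma norm_tau_periodic k : (N <= k)%N ->
  `|tau n e (k + N`!).+1| = `|tau n e k.+1|.
Proof.
move=> Nk; have [u uP] := norm_tau_int.
have [u0 -> u2] := uP k; have [u0' -> u2'] := uP (k + N`!)%N.
congr (_%:~R); apply/eqP; rewrite -(@eqrXn2 _ 2) ?ltW // u2 u2'.
by rewrite (tau_sq_period ell cP oP forms Nk).
Qed.

Lemma run_tau_prog : exists o, run tau_prog E P o /\
  describes o (fun k => `|tau n e k.+1|).
Proof.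
have [u uP] := norm_tau_int.
exists (N%:Z :: [seq u k | k <- iota 0 N] ++ [seq u k | k <- iota N N`!]).
split; last first.
  exists [seq u k | k <- iota 0 N], [seq u k | k <- iota N N`!].
  rewrite !size_map !size_iota fact_gt0; split=> // k.
  have [kN|Nk] := ltnP k N.
    by rewrite (nth_map 0%N) ?size_iota // nth_iota //; have [_ ->] := uP k.
  have lt : ((k - N) %% N`! < N`!)%N by rewrite ltn_mod fact_gt0.
  rewrite (nth_map 0%N) ?size_iota // nth_iota //.
  have [_ <- _] := uP (N + (k - N) %% N`!)%N.
  have := divn_eq (k - N) N`!; move: lt; set r := (_ %% _)%N; set q := (_ %/ _)%N.
  (* Descend from k to its representative N + r in the first cycle, one period at a time. *)
  move=> _ kE; have -> : k = (N + r + q * N`!)%N by lia.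
  elim: q {kE} => [|q IHq]; first by rewrite addn0.
  rewrite mulSnr addnA norm_tau_periodic //; lia.
suff [s x _] : computes tau_prog (input E P)
    (N%:Z :: [seq u k | k <- iota 0 (N + N`!)]) (fun _ => True).
  by exists s; rewrite iotaD map_cat in x.
have DP : exists x y, P = Aff x y.
  by case: (df 0) => [+ _ _ _]; rewrite /= addpt_Inf => ->; do 2 eexists.
have [x [y DxyP]] := DP.
have f0 : coprime_form P (numq x) (numq y) (denq y %/ denq x)%Z.
  have := df 0; rewrite [mulpt _ _ _]/= addpt_Inf DxyP; exact: input_form.
pose b := bound E.
have NE : N%:Z = (b ^+ 2) ^+ 3.
  rewrite /preperiod; have -> : bound E ^+ 6 = (b ^+ 2) ^+ 3 by rewrite -exprM.
  by rewrite abszE ger0_norm // exprn_ge0 // sqr_ge0.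
do 5 apply: computes_assign; set s := upd _ 10 _.
have hs : holds_curve E s.
  by rewrite /s DxyP; split.
have s8 : s 8%N = N%:Z by case: hs => _ _ _ h7; rewrite NE -h7 /s /upd /=; ring.
have fs : coprime_form P (s 3%N) (s 5%N) (s 6%N) by move: f0; rewrite /s DxyP.
rewrite -[_ :: _]cat0s.
have s10 : s 10%N = N%:Z by rewrite -s8.
apply: (computes_seq (computes_factorial (erefl : s 9%N = 1) s10)).
move=> s1 [s1f hi]; apply: computes_assign; set s2 := upd _ 10 _.
have s210 : s2 10%N = (N + N`!)%N%:Z by rewrite /s2 /upd /= hi // s8 s1f PoszD.
have hi2 i : (i < 9)%N -> s2 i = s i.
  by move=> i9; rewrite /s2 /upd ifF ?hi //; lia.
rewrite -cat1s; apply: (@computes_seq _ _ _ _ _ (fun s => s = s2)).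
  by exists s2 => //; rewrite -s8 -(hi2 8) //; exact: exec_print.
move=> _ ->.
(* The registers hold some coprime form of Q_k, possibly differing in signs from (m k, n k, e k). *)
pose I k (s' : store) := [/\ holds_curve E s',
  coprime_form (Q k) (s' 3%N) (s' 5%N) (s' 6%N) & s' 10%N = (N + N`! - k)%N%:Z].
have -> : [seq u k | k <- iota 0 (N + N`!)] =
    flatten [seq [:: u k] | k <- iota 0 (N + N`!)] by elim: (iota _ _) => //= i r ->.
have [|||s3 x3 _] := @computes_while (Var 10) doubling_step (N + N`!)%N I
    (fun k => [:: u k]) s2; last by exists s3.
- move=> k s' kK [hs' f' s'10]; split; first by rewrite /= s'10 ltz_nat subn_gt0.
  have [u0 _ u2] := uP k; have cQ := mulpt_on (2 ^ k) cP.
  have nI : addpt E (Q k) (Q k) <> Inf.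
    by rewrite -mulpt_exp2S //; apply: oP; rewrite expn_gt0.
  have u2' : u k ^+ 2 = tau_sq E (s' 3%N) (s' 5%N) (s' 6%N).
    by rewrite u2; exact: tau_sq_uniq cQ (forms k) f'.
  have [s4 x4 [hs4 f4 e4]] := computes_doubling_step ell cQ nI hs' f' u0 u2'.
  exists s4 => //; split=> //; first by rewrite mulpt_exp2S.
  by rewrite e4 s'10; lia.
- by move=> s' [_ _ /= ->]; rewrite subnn.
- split; last by rewrite subn0.
    by case: hs => h0 h1 h2 h7; split; rewrite hi2.
  by rewrite !hi2 //= addpt_Inf.
Qed.
End MainTheorem.

Theorem theorem1p8 :
  (forall (E : curve) (P : point) (m n e : nat -> int),
     elliptic E -> on_curve E P -> infinite_order E P ->
     doubling_forms E P m n e ->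
     eventually_periodic (fun k : nat => `|tau n e k.+1|))
  /\
  (exists alg : prog,
     forall (E : curve) (P : point) (m n e : nat -> int),
       elliptic E -> on_curve E P -> infinite_order E P ->
       doubling_forms E P m n e ->
       exists o : seq int,
         run alg E P o /\ describes o (fun k : nat => `|tau n e k.+1|)).
Proof.
split=> [E P m n e ell cP oP df|].
  exists (preperiod E), (preperiod E)`!; split; first exact: fact_gt0.
  exact: norm_tau_periodic ell cP oP df.
by exists tau_prog => E P m n e; exact: run_tau_prog.
Qed.
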